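(* Let $\mathbb{F}$ be an algebraically closed field of characteristic $p>2$, $V$ a $\frac12\mathbb{Z}$-graded vertex superalgebra over $\mathbb{F}$, and $g$ an automorphism of $V$ of finite order $T$ relatively prime to $p$. Then the subspace $O_g(V)$ is a two-sided ideal of the non-associative algebra $(V,*_g)$, and the product $*_g$ induces an associative algebra structure on $A_g(V)=V/O_g(V)$ with identity element $\mathbf 1+O_g(V)$.
   Context: Conventions. $\mathbb{N}=\{0,1,2,\dots\}$; $\mathbb{D}=\{m/n\in\mathbb{Q}: p\nmid n\}$; for $\alpha\in\mathbb{D}$, $\binom{\alpha}{i}=\alpha(\alpha-1)\cdots(\alpha-i+1)/i!$ is viewed in $\mathbb{F}$ via $\mathbb{D}\to\mathbb{Z}/p\subset\mathbb{F}$; $(z_1+z_2)^\alpha:=\sum_{i\ge0}\binom{\alpha}{i}z_1^{\alpha-i}z_2^i$; $\delta(z)=\sum_{n\in\mathbb{Z}}z^n$; $\mathrm{Res}_z$ is the coefficient of $z^{-1}$. A vertex superalgebra is a $\mathbb{Z}_2$-graded space $V=V_{\bar0}\oplus V_{\bar1}$ with $\mathbf 1\in V_{\bar0}$ and a linear map $v\mapsto Y(v,x)=\sum_{n\in\mathbb{Z}}v_nx^{-n-1}\in(\mathrm{End}\,V)[[x,x^{-1}]]$ such that $u_nv\in V_{\alpha+\beta}$ for $u\in V_\alpha,v\in V_\beta$; $u_nv=0$ for $n$ large; $Y(\mathbf 1,x)=1_V$; $Y(v,x)\mathbf 1\in V[[x]]$ with constant term $v$; and for $\mathbb{Z}_2$-homogeneous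 $u,v$ (parities $|u|,|v|$) $$x_0^{-1}\delta\Big(\tfrac{x_1-x_2}{x_0}\Big)Y(u,x_1)Y(v,x_2)-(-1)^{|u||v|}x_0^{-1}\delta\Big(\tfrac{x_2-x_1}{-x_0}\Big)Y(v,x_2)Y(u,x_1)=x_2^{-1}\delta\Big(\tfrac{x_1-x_0}{x_2}\Big)Y(Y(u,x_0)v,x_2).$$ It is $\frac12\mathbb{Z}$-graded if $V=\bigoplus_{q\in\frac12\mathbb{Z}}V_q$ with $\mathbf 1\in V_0$, $V_{\bar0}=\bigoplus_{n\in\mathbb{Z}}V_n$, $V_{\bar1}=\bigoplus_{n\in\frac12+\mathbb{Z}}V_n$, and $u_kV_n\subset V_{m+n-k-1}$ for $u\in V_m$, $k\in\mathbb{Z}$; $\deg a=n$ for $a\in V_n$. An automorphism is a linear bijection fixing $\mathbf 1$ and satisfying $\phi(Y(a,z)b)=Y(\phi(a),z)\phi(b)$; $g$ is assumed to preserve the $\frac12\mathbb{Z}$-grading. The parity automorphism is $\sigma(a)=(-1)^{|a|}a$, and $T_0$ is the order of $g\sigma$. Let $\varepsilon\in\mathbb{F}$ be a primitive $T_0$-th root of unity and $V^{r*}=\{v\in V: g\sigma v=\varepsilon^rv\}$, $0\le r<T_0$, so $V=\bigoplus_rV^{r*}$. For homogeneous $u\in V^{r*}$, $v\in V$, $n\in\mathbb{N}$: $u\circ_g^nv=\mathrm{Res}_z\frac{(1+z)^{\deg u}}{z^{2+n}}Y(u,z)v$ if $r=0$, and $u\circ_g^nv=\mathrm{Res}_z\frac{(1+z)^{\deg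 u-1+r/T_0}}{z^{1+n}}Y(u,z)v$ if $0<r<T_0$; $u*_gv=\mathrm{Res}_z\frac{(1+z)^{\deg u}}{z}Y(u,z)v$ if $r=0$, and $u*_gv=0$ if $0<r<T_0$; both extended bilinearly to $V$. $O_g(V)=\mathrm{span}\{a\circ_g^nb: a,b\in V,\ n\in\mathbb{N}\}$. *)

(* Defs.v *)
From HB Require Import structures.
From mathcomp Require Import all_boot all_order all_algebra.
From mathcomp Require Import boolp classical_sets functions cardinality fsbigop.

Set Implicit Arguments.
Unset Strict Implicit.
Unset Printing Implicit Defensive.

Import GRing.Theory.
Local Open Scope ring_scope.
Local Open Scope quotient_scope.
Local Open Scope classical_set_scope.

Section Subspaces.
Variables (F : fieldType) (V : lmodType F).

Definition span (X : set V) : {pred V} := fun v =>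
  `[< exists2 s : seq (F * V), (forall x, x \in s -> X x.2)
      & v = \sum_(x <- s) x.1 *: x.2 >].

Lemma span_submod_closed (X : set V) : submod_closed (span X).
Proof.
split=> [|a u v /asboolP[s sX ->] /asboolP[t tX ->]]; apply/asboolP.
  by exists [::] => //; rewrite big_nil.
exists ([seq (a * x.1, x.2) | x <- s] ++ t).
  by move=> x; rewrite mem_cat => /orP[/mapP[y /sX Xy ->]|/tX].
rewrite big_cat big_map scaler_sumr; congr (_ + _).
by apply: eq_bigr => x _; rewrite scalerA.
Qed.

HB.instance Definition _ (X : set V) :=
  GRing.isSubmodClosed.Build F V (span X)
    (GRing.submod_closed_semi (span_submod_closed X)).

(* The finitely supported families (c i) with c i in W i and sum v; the sum
   over [set: I] is the library's sum of a finitely supported family. *)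
Definition decomposition (I : choiceType) (W : I -> {pred V}) (v : V) :
    set (I -> V) :=
  [set c | [/\ finite_set [set i | c i != 0], forall i, c i \in W i
             & v = \sum_(i \in [set: I]) c i]].

Definition is_direct_sum (I : choiceType) (W : I -> {pred V}) (U : {pred V}) :=
  [/\ forall i, submod_closed (W i),
      forall v, v \in U <-> exists c, decomposition W v c
    & forall v, is_subset1 (decomposition W v)].

(* The components of v along V = \bigoplus_i W i. *)
Definition component (I : choiceType) (W : I -> {pred V}) (v : V) : I -> V :=
  xget (fun=> 0) (decomposition W v).

(* The linear extension to V = \bigoplus_i W i of a map that is given by f i
   on W i. *)
Definition linear_extension (I : choiceType) (W : I -> {pred V})
    (U : lmodType F) (f : I -> V -> U) (v : V) : U :=
  \sum_(i \in [set: I]) f i (component W v i).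

End Subspaces.

(* The quotient V / S as a vector space; the library has only the quotient of
   the additive group. *)
Section QuotientSpace.
Variables (F : fieldType) (V : lmodType F) (S : submodClosed V).

Let S_zmod : zmodClosed V :=
  HB.pack (S : {pred V}) (GRing.isZmodClosed.Build V (S : {pred V})
    (GRing.submod_closedB (submodClosedP S))).

Let Q := Quotient.quot S_zmod.

Definition quotient_space : Type := Q.

HB.instance Definition _ := GRing.Zmodule.on quotient_space.

Definition to_quotient (v : V) : quotient_space := \pi_Q v.

Let repK (x : quotient_space) : to_quotient (repr (x : Q)) = x.
Proof. exact: reprK. Qed.

Let toqD : {morph to_quotient : u v / u + v}.
Proof. by move=> u v; rewrite /to_quotient -[RHS]/(_ + _ : Q) !piE. Qed.

Lemma to_quotient_eq u v : to_quotient u = to_quotient v <-> u - v \in S.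
Proof. by rewrite (Quotient.idealrBE S_zmod); split=> /eqP. Qed.

Definition quotient_scale (a : F) (x : quotient_space) : quotient_space :=
  to_quotient (a *: repr (x : Q)).

Let scaleE a v : quotient_scale a (to_quotient v) = to_quotient (a *: v).
Proof.
by apply/to_quotient_eq; rewrite -scalerBr rpredZ//; apply/to_quotient_eq.
Qed.

Fact quotient_scaleA a b x :
  quotient_scale a (quotient_scale b x) = quotient_scale (a * b) x.
Proof. by rewrite -(repK x) !scaleE scalerA. Qed.

Fact quotient_scale1 : left_id 1 quotient_scale.
Proof. by move=> x; rewrite -(repK x) scaleE scale1r. Qed.

Fact quotient_scaleDr : right_distributive quotient_scale +%R.
Proof.
by move=> a x y; rewrite -(repK x) -(repK y) -toqD !scaleE scalerDr toqD.
Qed.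

Fact quotient_scaleDl x :
  {morph quotient_scale^~ x : a b / a + b}.
Proof. by move=> a b; rewrite -(repK x) !scaleE scalerDl toqD. Qed.

HB.instance Definition _ := GRing.Zmodule_isLmodule.Build F quotient_space
  quotient_scaleA quotient_scale1 quotient_scaleDr quotient_scaleDl.

Lemma to_quotient_is_linear : linear to_quotient.
Proof. by move=> a u v; rewrite toqD -scaleE. Qed.

End QuotientSpace.

(* A formal series, possibly infinite in all directions, is its family of
   coefficients, indexed by G = int for one variable z and by
   G = int * int * int for the variables (x0, x1, x2). *)
Section FormalSeries.
Variable F : fieldType.

Definition binomial_rat (alpha : rat) (i : nat) : rat :=
  (\prod_(j < i) (alpha - j%:R)) / (i`!)%:R.

(* ratr sends m / n to the quotient of the images of m and n in F, so it is
   the map D -> Z/p -> F on fractions whose denominator is prime to p. *)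
Definition binomialF (alpha : rat) (i : nat) : F := ratr (binomial_rat alpha i).

Definition onepz (alpha : rat) (k : int) : F :=
  if k is Posz i then binomialF alpha i else 0.

(* z^s A(z) *)
Definition shift (s : int) (A : int -> F) (k : int) : F := A (k - s).

(* The coefficient of z1^i z2^j in (z1 - z2)^n. *)
Definition subpow (n i j : int) : F :=
  if i + j == n then (-1) ^ j * onepz n%:~R j else 0.

(* The coefficient of z0^a z1^b z2^c in
   z0^-1 delta ((z1 - z2) / z0) = \sum_n z0^(-n-1) (z1 - z2)^n. *)
Definition delta3 (a b c : int) : F := subpow (- a - 1) b c.

(* Product of a scalar series and a vector series; the sum defining each
   coefficient is finite wherever this is used below. *)
Definition series_mul (V : lmodType F) (G : zmodType) (A : G -> F) (f : G -> V)
    (m : G) : V :=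
  \sum_(k \in [set: G]) A k *: f (m - k).

Definition Res (V : lmodType F) (f : int -> V) : V := f (-1).

End FormalSeries.

Section VertexSuperalgebra.
Variables (F : fieldType) (V : lmodType F).

Implicit Types (Y : V -> int -> V -> V) (u v w : V).

(* Y u n v is u_n v, so Y(u, x) v = \sum_n (u_n v) x^(-n-1). *)
Definition Yser Y u v (k : int) : V := Y u (- k - 1) v.

(* The coefficients at x0^a x1^b x2^c of Y(u,x1) Y(v,x2) w,
   Y(v,x2) Y(u,x1) w and Y(Y(u,x0)v, x2) w. *)
Definition YY12 Y u v w (m : int * int * int) : V :=
  let: (a, b, c) := m in
  if a == 0 then Yser Y u (Yser Y v w c) b else 0.

Definition YY21 Y u v w (m : int * int * int) : V :=
  let: (a, b, c) := m in
  if a == 0 then Yser Y v (Yser Y u w b) c else 0.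

Definition YY02 Y u v w (m : int * int * int) : V :=
  let: (a, b, c) := m in
  if b == 0 then Yser Y (Yser Y u v a) w c else 0.

(* x0^-1 delta ((x1 - x2) / x0),  x0^-1 delta ((x2 - x1) / (- x0)) and
   x2^-1 delta ((x1 - x0) / x2); the second is - z0^-1 delta ((x2 - x1) / z0)
   at z0 = - x0. *)
Definition delta_012 (m : int * int * int) : F :=
  let: (a, b, c) := m in delta3 F a b c.

Definition delta_021 (m : int * int * int) : F :=
  let: (a, b, c) := m in - ((-1) ^ a * delta3 F a c b).

Definition delta_210 (m : int * int * int) : F :=
  let: (a, b, c) := m in delta3 F c b a.

Definition jacobi Y (i j : bool) u v := forall w m,
  series_mul delta_012 (YY12 Y u v w) m
    - (-1) ^+ (i && j) *: series_mul delta_021 (YY21 Y u v w) m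
  = series_mul delta_210 (YY02 Y u v w) m.

(* The parity false is even and the parity true is odd. *)
Record vertex_superalgebra := VertexSuperalgebra {
  parity : bool -> {pred V};
  vac : V;
  mode : V -> int -> V -> V;
  parity_direct : is_direct_sum parity predT;
  vac_even : vac \in parity false;
  mode_linear_l : forall n v, linear (fun u => mode u n v);
  mode_linear_r : forall u n, linear (mode u n);
  mode_parity : forall i j u v n,
    u \in parity i -> v \in parity j -> mode u n v \in parity (i (+) j);
  mode_truncation : forall u v, exists N : int,
    forall n : int, (N <= n)%R -> mode u n v = 0;
  mode_vac : forall n v, mode vac n v = if n == -1 then v else 0;
  mode_creation : forall v (n : int), (0 <= n)%R -> mode v n vac = 0;
  mode_creation1 : forall v, mode v (-1) vac = v;
  mode_jacobi : forall i j u v,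
    u \in parity i -> v \in parity j -> jacobi mode i j u v
}.

(* grade S k is V_(k/2), the vectors of degree k / 2. *)
Record half_graded := HalfGraded {
  vsa :> vertex_superalgebra;
  grade : int -> {pred V};
  grade_direct : is_direct_sum grade predT;
  grade_vac : vac vsa \in grade 0;
  grade_even : is_direct_sum (fun n : int => grade (2 * n)) (parity vsa false);
  grade_odd : is_direct_sum (fun n : int => grade (2 * n + 1)) (parity vsa true);
  grade_mode : forall (m n k : int) u v, u \in grade m -> v \in grade n ->
    mode vsa u k v \in grade (m + n - 2 * k - 2)
}.

Definition degree (k : int) : rat := k%:~R / 2%:R.

Definition is_automorphism (S : vertex_superalgebra) (phi : V -> V) :=
  [/\ linear phi, bijective phi, phi (vac S) = vac S
    & forall a n b, phi (mode S a n b) = mode S (phi a) n (phi b)].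

Definition preserves_grading (S : half_graded) (phi : V -> V) :=
  forall k v, v \in grade S k -> phi v \in grade S k.

Definition has_order (phi : V -> V) (n : nat) :=
  [/\ (0 < n)%N, iter n phi =1 id
    & forall m, (0 < m < n)%N -> ~ iter m phi =1 id].

Definition sigma (S : vertex_superalgebra) : V -> V :=
  linear_extension (parity S) (fun (i : bool) v => (-1) ^+ i *: v).

Section Zhu.
Variables (S : half_graded) (g : V -> V) (T0 : nat) (eps : F).

(* V^{r*} *)
Definition eigenspace_star (r : nat) : {pred V} :=
  [pred v | g (sigma S v) == eps ^+ r *: v].

Definition bigrade (i : int * 'I_T0) : {pred V} :=
  [pred v | (v \in grade S i.1) && (v \in eigenspace_star i.2)].

(* Res_z (1 + z)^alpha z^(- s) Y(u, z) v *)
Definition res_prod (alpha : rat) (s : nat) u v : V :=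
  Res (series_mul (shift (- s%:Z) (onepz F alpha)) (Yser (mode S) u v)).

Definition circ_homog (n : nat) (i : int * 'I_T0) u v : V :=
  if i.2 == 0%N :> nat then res_prod (degree i.1) (2 + n) u v
  else res_prod (degree i.1 - 1 + (i.2 : nat)%:R / T0%:R) (1 + n) u v.

Definition star_homog (i : int * 'I_T0) u v : V :=
  if i.2 == 0%N :> nat then res_prod (degree i.1) 1 u v else 0.

Definition circ (n : nat) (u v : V) : V :=
  linear_extension bigrade (fun i x => circ_homog n i x v) u.

Definition star (u v : V) : V :=
  linear_extension bigrade (fun i x => star_homog i x v) u.

Definition circ_values : set V :=
  [set w | exists a b n, w = circ n a b].

Definition Og : {pred V} := span circ_values.

HB.instance Definition _ := GRing.SubmodClosed.on Og.

Definition Ag : lmodType F := quotient_space Og.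

Definition to_Ag (v : V) : Ag := to_quotient Og v.

End Zhu.

Definition two_sided_ideal (mul : V -> V -> V) (I : {pred V}) :=
  submod_closed I /\
  forall a b, b \in I -> mul a b \in I /\ mul b a \in I.

End VertexSuperalgebra.

Definition unital_associative_algebra (F : fieldType) (A : lmodType F)
    (mul : A -> A -> A) (e : A) :=
  [/\ forall x, linear (mul x), forall y, linear (mul^~ y),
      associative mul, left_id e mul & right_id e mul].

(* Main.v *)
Require Import Defs.
From HB Require Import structures.
From mathcomp Require Import all_boot all_order all_algebra.
From mathcomp Require Import boolp classical_sets functions cardinality fsbigop.
From mathcomp Require Import ring zify.

Set Implicit Arguments.
Unset Strict Implicit.
Unset Printing Implicit Defensive.

Import GRing.Theory Num.Theory.
Local Open Scope ring_scope.

(** The theorem is Zhu's, and its proof works in characteristic [p] because it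
    uses neither the derivation [L(-1)] nor skew-symmetry, but only residues of
    the Jacobi identity.

    Write [R(al, s; u, v) = Res_z (1 + z)^al z^(- s) Y(u, z) v]
    ([Res_pow]). For a homogeneous eigenvector [u], the products of the theory
    are of this form: [star u v] is [R(deg u, 1; u, v)] if [g sigma] fixes [u]
    and [0] otherwise, and [circ n u v] is [R(al, e + n; u, v)] where [al]
    ([circ_exp]) and [e] ([circ_pole]) depend only on the bidegree of [u], which
    is the pair of its degree and its eigenvalue. As
    [(1 + z)^(al + 1) = (1 + z)^al + z (1 + z)^al], the space [O] spanned by the
    [circ n u v] contains [R(al + m, e + n; u, v)] for all [m <= n]
    ([Res_pow_Og]). It also contains the eigenvectors not fixed by [g sigma]
    ([bigrade_Og]).

    Multiplying the Jacobi identity by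
    [x0^(- s0) x1^(- s1) (1 + x1)^al x2^(- s2) (1 + x2)^be] and taking residues
    gives one identity between iterated [R]'s ([Res_Jacobi]). For [s0 = 0] it is
    a commutator formula, from which [O] is a left ideal ([star_circ_Og]). For
    [s1 = 0] it is an iterate formula, which expresses products whose left
    factor is [circ n a b] or [star u v]; it gives that [O] is a right ideal
    ([circ_star_Og]), and that [star] is associative modulo [O]
    ([star_assoc]). In each case what has to be checked is that the exponents
    of [1 + z] and the poles in the resulting terms satisfy [m <= n] above. The
    vacuum is a unit on the vectors fixed by [g sigma], because only the mode
    [-1] contributes to the products with it, and modulo [O] there are no
    others.

    Two more ingredients are needed. The exponents are rationals with
    denominators prime to [p]; such a rational is p-adically close to natural
    numbers, and its binomial coefficients reduce in [F] to those of a close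
    enough natural number ([binomialF_approx]), whence Vandermonde's identity
    in [F]. And [V] is the direct sum of the spaces of given degree
    and eigenvalue ([bigrade_direct]), the eigenprojections being averages over
    the powers of [g sigma], whose order is invertible in [F]. *)

(** * Binomial coefficients at p-integral rationals *)

(** The rationals whose reduced denominator is prime to [p]; they form a
    subring. *)
Definition p_integral (p : nat) : {pred rat} :=
  fun x => coprime `|denq x| p.

Lemma p_integral_frac p (n d : int) :
  coprime `|d| p -> n%:~R / d%:~R \in p_integral p.
Proof.
rewrite /in_mem /= /p_integral; case: divqP => [|k x k0].
  by rewrite coprime1n.
by rewrite abszM coprimeMl => /andP[].
Qed.

Lemma p_integralP p (x : rat) : x \in p_integral p ->
  exists n d : int, [/\ d != 0, coprime `|d| p & x = n%:~R / d%:~R].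
Proof.
move=> xD; exists (numq x), (denq x); split; first exact: denq_neq0.
  exact: xD.
by rewrite divq_num_den.
Qed.

Lemma p_integral_subring p : subring_closed (p_integral p).
Proof.
split=> [|x y /p_integralP[n [d [d0 dp ->]]] /p_integralP[m [e [e0 ep ->]]]|
  x y /p_integralP[n [d [d0 dp ->]]] /p_integralP[m [e [e0 ep ->]]]].
- by rewrite -[1](divr1 1); apply: (@p_integral_frac p 1 1); rewrite coprime1n.
- have -> : n%:~R / d%:~R - m%:~R / e%:~R
      = (n * e - m * d)%:~R / (d * e)%:~R :> rat.
    rewrite !(intrM, intrB) -mulNr addf_div ?intq_eq0 //.
    by rewrite mulNr.
  by apply: p_integral_frac; rewrite abszM coprimeMl dp.
- rewrite mulf_div -!intrM.
  by apply: p_integral_frac; rewrite abszM coprimeMl dp.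
Qed.

HB.instance Definition _ p :=
  GRing.isSubringClosed.Build rat (p_integral p) (p_integral_subring p).

(** [alpha] is congruent to the natural number [n] modulo [p ^ M] in the ring
    of p-integral rationals. *)
Definition p_approx (p M : nat) (alpha : rat) (n : nat) : Prop :=
  exists2 z, z \in p_integral p & alpha = n%:R + (p ^ M)%:R * z.

Lemma p_approxD p M a b m n :
  p_approx p M a m -> p_approx p M b n -> p_approx p M (a + b) (m + n).
Proof.
move=> [y yD ->] [z zD ->]; exists (y + z); first by rewrite rpredD.
by rewrite natrD; ring.
Qed.

Lemma p_approx_nat p M n : p_approx p M n%:R n.
Proof. by exists 0; rewrite ?rpred0 // mulr0 addr0. Qed.

Lemma p_approx_sub p M a n l : (l <= n)%N ->
  p_approx p M a n -> p_approx p M (a - l%:R) (n - l).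
Proof.
move=> ln [z zD ->]; exists z => //.
by rewrite natrB //; ring.
Qed.

(** Naturals are dense in the p-integral rationals; the approximation can
    moreover be chosen arbitrarily large. *)
Lemma p_approx_exists p M l a : prime p -> a \in p_integral p ->
  exists2 n, (l <= n)%N & p_approx p M a n.
Proof.
move=> pp aD; have [c [d [d0 dp aE]]] := p_integralP aD.
set q := (p ^ M)%N.
have q_gt0 : (0 < q)%N by rewrite expn_gt0 prime_gt0.
have dq : coprimez d q by rewrite coprimezE /= coprimeXr.
have /coprimezP[[u v] /= uv] := dq.
pose n0 := c * u + `|(c * u)%R|%N%:Z * q%:Z.
have n0_ge0 : 0 <= n0 by rewrite /n0; nia.
exists (`|n0| + l * q)%N; first by nia.
exists (a * v%:~R - `|(c * u)%R|%N%:R - l%:R).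
  by rewrite !rpredB ?rpredM ?rpred_int ?rpred_nat.
have d_neq0 : d%:~R != 0 :> rat by rewrite intq_eq0.
have n0E : (`|n0|%N)%:R = c%:~R * u%:~R + `|(c * u)%R|%N%:R * q%:R :> rat.
  by rewrite -[LHS]/((`|n0|%N : int)%:~R) gez0_abs // /n0 !(intrD, intrM).
rewrite natrD natrM n0E aE -/q.
(* c / d = c u + q (c / d) v because u d + v q = 1 *)
have /(congr1 (fun z : int => z%:~R : rat)) := uv.
rewrite !(intrD, intrM) -[RHS]/1 => uvq.
have bezout (x y z s t : rat) : y != 0 -> s * y + t * z = 1 ->
    x / y = x * s + z * (x / y * t).
  by move=> y0 st; rewrite -[LHS]mulr1 -st; field.
by rewrite [LHS](bezout _ _ q%:R _ _ d_neq0 uvq); ring.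
Qed.

Lemma binomial_ratS (a : rat) i :
  binomial_rat a i.+1 = binomial_rat a i * ((a - i%:R) / i.+1%:R).
Proof.
by rewrite /binomial_rat big_ord_recr factS natrM invfM /=; ring.
Qed.

Lemma binomial_rat_nat n i : binomial_rat n%:R i = 'C(n, i)%:R.
Proof.
elim: i => [|i IH].
  by rewrite /binomial_rat big_ord0 bin0 divr1.
rewrite binomial_ratS IH mulrA; apply: (canLR (mulfK _)).
  by rewrite pnatr_eq0.
rewrite -natrM mulnC mul_bin_left natrM mulrC.
case: (leqP i n) => [le_in|lt_ni]; first by rewrite natrB.
by rewrite bin_small // !mulr0.
Qed.

(** Binomial coefficients are p-adically continuous. In particular they take
    p-integral rationals to p-integral rationals. *)
Lemma binomial_rat_approx p a n i M : prime p -> (i`! <= M)%N ->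
    p_approx p M a n ->
  exists2 z, z \in p_integral p & binomial_rat a i = 'C(n, i)%:R + p%:R * z.
Proof.
move=> pp iM [z zD aE].
have aD : a \in p_integral p.
  by rewrite aE rpredD ?rpredM ?rpred_nat.
have [y yD yE] : exists2 y, y \in p_integral p &
    \prod_(j < i) (a - j%:R)
    = \prod_(j < i) (n%:R - j%:R) + (p ^ M)%:R * y :> rat.
  elim: i {iM} => [|i [y yD yE]].
    by exists 0; rewrite ?rpred0 // !big_ord0 mulr0 addr0.
  exists (y * (a - i%:R) + \prod_(j < i) (n%:R - j%:R) * z).
    rewrite rpredD ?rpredM ?rpredB ?rpred_nat // rpred_prod // => j _.
    by rewrite rpredB ?rpred_nat.
  rewrite !big_ord_recr /= yE {2}aE aE.
  by ring.
have [m pm im] := pfactor_coprime pp (fact_gt0 i).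
set v := logn p i`! in im.
have vM : (v < M)%N.
  by apply: leq_trans iM; rewrite ltn_logl // fact_gt0.
have pE : (p ^ M = p * (p ^ (M - v.+1) * p ^ v))%N.
  by rewrite -expnD -expnS; congr (_ ^ _)%N; lia.
exists ((p ^ (M - v.+1))%:R * (y / m%:R)).
  rewrite rpredM ?rpred_nat // rpredM //.
  rewrite -[m%:R^-1]mul1r.
  by apply: (@p_integral_frac p 1 m); rewrite coprime_sym.
rewrite -binomial_rat_nat /binomial_rat yE mulrDl; congr (_ + _).
rewrite im pE !natrM.
have m0 : m%:R != 0 :> rat.
  by rewrite pnatr_eq0; case: (m) im => // im; move: (fact_gt0 i); rewrite im.
have p0 : (p ^ v)%:R != 0 :> rat.
  by rewrite pnatr_eq0 expn_eq0 negb_and -lt0n prime_gt0.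
by field; rewrite m0 p0.
Qed.

Section BinomialF.
Variables (F : fieldType) (p : nat) (p_char : p \in [pchar F]).

Let p_prime : prime p := pcharf_prime p_char.

Local Notation D := (p_integral p).
Local Notation B := (binomialF F).

Lemma intr_coprime_neq0 (d : int) : coprime `|d| p -> d%:~R != 0 :> F.
Proof.
move=> dp; have : (`|d|%N)%:R != 0 :> F.
  by rewrite -(dvdn_pcharf p_char) -prime_coprime // coprime_sym.
by case: d {dp} => n //; rewrite NegzE mulrNz oppr_eq0.
Qed.

(** [ratr] may be computed on any fraction whose denominator is prime to the
    characteristic, reduced or not. *)
Lemma ratr_frac (n d : int) : coprime `|d| p -> d != 0 ->
  ratr (n%:~R / d%:~R) = n%:~R / d%:~R :> F.
Proof.
move=> dp d0; pose x : rat := n%:~R / d%:~R; rewrite -/x /ratr.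
have xD : coprime `|denq x| p by exact: p_integral_frac.
apply/eqP; rewrite eqr_div ?intr_coprime_neq0 // -!intrM; apply/eqP.
congr (_%:~R); apply/eqP; rewrite -(eqr_int rat) !intrM.
by rewrite numqE /x mulrAC divfK ?intq_eq0 // mulrC.
Qed.

Lemma ratr_nat_congr n z : z \in D -> ratr (n%:R + p%:R * z) = n%:R :> F.
Proof.
move=> /p_integralP[c [d [d0 dp ->]]].
have -> : n%:R + p%:R * (c%:~R / d%:~R)
    = (n%:Z * d + p%:Z * c)%:~R / d%:~R :> rat.
  rewrite intrD !intrM.
  have d1 : d%:~R != 0 :> rat by rewrite intq_eq0.
  by field.
rewrite ratr_frac // intrD !intrM.
have -> : (p%:Z)%:~R = 0 :> F by rewrite -[LHS]/(p%:R) (pcharf0 p_char).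
by rewrite mul0r addr0 mulfK // intr_coprime_neq0.
Qed.

(** In [F] a binomial coefficient at a p-integral rational is one at a natural
    number: [M >= i`!] is more than enough for the powers of [p] in [i`!] to
    cancel. *)
Lemma binomialF_approx a n i M : (i`! <= M)%N -> p_approx p M a n ->
  B a i = 'C(n, i)%:R.
Proof.
move=> iM an; rewrite /binomialF.
by have [z zD ->] := binomial_rat_approx p_prime iM an; rewrite ratr_nat_congr.
Qed.

Lemma binomialF_nat n i : B n%:R i = 'C(n, i)%:R.
Proof. by rewrite /binomialF binomial_rat_nat ratr_nat. Qed.

Lemma binomialF0 a : B a 0 = 1.
Proof. by rewrite /binomialF /binomial_rat big_ord0 divr1 (ratr_nat _ 1). Qed.

(** This and the next two identities reduce to their analogues for natural
    numbers, by [binomialF_approx]. *)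
Lemma binomialF_Vandermonde a b i : a \in D -> b \in D ->
  \sum_(j < i.+1) B a j * B b (i - j) = B (a + b) i.
Proof.
move=> aD bD.
have [m _ am] := p_approx_exists i`! 0 p_prime aD.
have [n _ bn] := p_approx_exists i`! 0 p_prime bD.
rewrite (binomialF_approx _ (p_approxD am bn)) //.
rewrite -binomial.Vandermonde natr_sum.
apply: eq_bigr => j _; rewrite natrM.
rewrite (binomialF_approx _ am) ?(binomialF_approx _ bn) //.
  by rewrite leq_fact ?leq_subr.
by rewrite leq_fact // -ltnS.
Qed.

Lemma bin_trinomial n i l : (l <= i)%N ->
  ('C(n, i) * 'C(i, l) = 'C(n, l) * 'C(n - l, i - l))%N.
Proof.
move=> li; case: (leqP i n) => [le_in|lt_ni]; last first.
  rewrite (@bin_small n i) // mul0n.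
  case: (leqP l n) => [ln|nl]; last by rewrite (@bin_small n l).
  by rewrite (@bin_small (n - l)) ?muln0 //; lia.
apply/eqP; rewrite -(eqn_pmul2r (fact_gt0 l)) -(eqn_pmul2r (fact_gt0 (i - l))).
rewrite -(eqn_pmul2r (fact_gt0 (n - i))); apply/eqP.
have h1 := bin_fact le_in; have h2 := bin_fact li.
have h3 : ('C(n, l) * (l`! * (n - l)`!) = n`!)%N by apply: bin_fact; lia.
have h4 : ('C(n - l, i - l) * ((i - l)`! * (n - i)`!) = (n - l)`!)%N.
  have -> : (n - i = (n - l) - (i - l))%N by lia.
  by apply: bin_fact; lia.
transitivity n`!; first by rewrite -h1 -h2; ring.
by rewrite -h3 -h4; ring.
Qed.

Lemma binomialF_trinomial a i l : a \in D -> (l <= i)%N ->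
  B a i * 'C(i, l)%:R = B a l * B (a - l%:R) (i - l).
Proof.
move=> aD li; have [m lm am] := p_approx_exists i`! l p_prime aD.
rewrite !(binomialF_approx _ am) ?leq_fact //.
rewrite (binomialF_approx _ (p_approx_sub lm am)) ?leq_fact ?leq_subr //.
by rewrite -!natrM bin_trinomial.
Qed.

Lemma binomialF_Pascal a i : a \in D -> B (a + 1) i.+1 = B a i.+1 + B a i.
Proof.
move=> aD; have [m _ am] := p_approx_exists i.+1`! 0 p_prime aD.
rewrite (binomialF_approx _ (p_approxD am (p_approx_nat p _ 1))) //.
rewrite !(binomialF_approx _ am) ?leq_fact //.
by rewrite addn1 binS natrD.
Qed.

(** The coefficient of [z ^ n] in the product of [(1 + z) ^ b] and the [l]-th
    divided derivative of [(1 + z) ^ a], multiplied by [z ^ l]. *)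
Lemma binomialF_convolution a b l n : a \in D -> b \in D ->
  \sum_(i < n.+1) B a i * 'C(i, l)%:R * B b (n - i)
  = if (l <= n)%N then B a l * B (a - l%:R + b) (n - l) else 0.
Proof.
move=> aD bD; case: leqP => [ln|nl]; last first.
  apply: big1 => i _; rewrite bin_small ?mulr0 ?mul0r //.
  exact: leq_trans (ltn_ord i) nl.
rewrite -binomialF_Vandermonde ?rpredB ?rpred_nat // mulr_sumr.
rewrite -!(big_mkord xpredT (fun i => B a i * 'C(i, l)%:R * B b (n - i))).
rewrite (big_cat_nat (n := l)) //=; last exact: leqW.
rewrite big_nat big1 ?add0r; last first.
  by move=> i /andP[_ il]; rewrite bin_small ?mulr0 ?mul0r.
rewrite -{1}[l]add0n big_addn subSn // big_mkord; apply: eq_bigr => i _.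
rewrite binomialF_trinomial ?leq_addl // addnK mulrA; congr (_ * B _ _).
by lia.
Qed.

Lemma ratrN (x : rat) : ratr (- x) = - ratr x :> F.
Proof. by rewrite /ratr numqN denqN mulrNz mulNr. Qed.

Lemma binomialF_upper_neg (m : int) j :
  B m%:~R j = (-1) ^+ j * B (j%:Z - m - 1)%:~R j.
Proof.
rewrite /binomialF.
have -> : binomial_rat m%:~R j = (-1) ^+ j * binomial_rat (j%:Z - m - 1)%:~R j.
  rewrite /binomial_rat mulrA; congr (_ / _).
  rewrite [in RHS](reindex_inj rev_ord_inj) /=.
  rewrite -[in (-1) ^+ j](card_ord j) -prodrN; apply: eq_bigr => i _.
  rewrite natrB // -natr1 !(intrB, intrD) /=.
  by ring.
rewrite -signr_odd -[in RHS]signr_odd.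
by case: (odd j); rewrite ?expr1 ?expr0 ?mul1r // mulN1r ratrN mulN1r.
Qed.

End BinomialF.

(** * The Jacobi identity on modes *)

Lemma fsum_nat (T : choiceType) (V : zmodType) (f : T -> V) (h : nat -> T) K :
    injective h ->
    (forall t, f t != 0 -> exists2 j, (j < K)%N & t = h j) ->
  \sum_(t \in [set: T]) f t = \sum_(j < K) f (h j).
Proof.
move=> h_inj fh; rewrite (fsbigE [seq h j | j <- iota 0 K]).
- rewrite big_map -[K in iota 0 K]subn0 big_mkord; apply: eq_bigl => i.
  by rewrite in_setT.
- by rewrite map_inj_uniq ?iota_uniq.
- by [].
move=> t _; apply: contraNeq => /fh[j jK ->].
by rewrite map_f // mem_iota.
Qed.

Section Borcherds.
Variables (F : fieldType) (V : lmodType F) (Y : V -> int -> V -> V).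
Hypotheses (Y0l : forall n v, Y 0 n v = 0) (Y0r : forall u n, Y u n 0 = 0).
Local Notation B := (binomialF F).

(** The three coefficients of the Jacobi identity at
    [x0^(-l-1) x1^(-m-1) x2^(-n-1)] as finite sums. *)
Lemma series_mul_YY12 u v w (l m n : int) K :
    (forall j, (K <= j)%N -> Y v (n + j%:Z) w = 0) ->
  series_mul (@delta_012 F) (YY12 Y u v w) (- l - 1, - m - 1, - n - 1)
  = \sum_(j < K) ((-1) ^+ j * B l%:~R j) *:
      Y u (m + l - j%:Z) (Y v (n + j%:Z) w).
Proof.
move=> vw0; rewrite /series_mul.
rewrite (@fsum_nat _ _ _ (fun j : nat => (- l - 1, l - j%:Z, j%:Z)) K).
- apply: eq_bigr => j _.
  rewrite /delta_012 /delta3 /subpow /YY12 /Yser /= subrr eqxx.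
  have -> : - (- l - 1) - 1 = l by ring.
  rewrite subrK eqxx; congr (_ *: Y _ _ (Y _ _ _)); ring.
- by move=> i j [].
move=> [[k0 k1] k2] /=.
rewrite /delta_012 /delta3 /subpow /YY12 /Yser /=.
case: (eqVneq (- l - 1 - k0) 0) => [k0E|_]; last by rewrite scaler0 eqxx.
case: (k1 + k2 =P _) => [k12|_]; last by rewrite scale0r eqxx.
case: k2 k12 => k2 k12; last by rewrite /onepz mulr0 scale0r eqxx.
have vE : - (- n - 1 - k2%:Z) - 1 = n + k2%:Z by ring.
rewrite vE; case: (ltnP k2 K) => [k2K _|Kk2]; last first.
  by rewrite vw0 // Y0r scaler0 eqxx.
by exists k2 => //; congr (_, _, _); lia.
Qed.

Lemma series_mul_YY21 u v w (l m n : int) K :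
    (forall j, (K <= j)%N -> Y u (m + j%:Z) w = 0) ->
  series_mul (@delta_021 F) (YY21 Y u v w) (- l - 1, - m - 1, - n - 1)
  = \sum_(j < K) ((-1) ^ l * ((-1) ^+ j * B l%:~R j)) *:
      Y v (n + l - j%:Z) (Y u (m + j%:Z) w).
Proof.
move=> uw0; rewrite /series_mul.
rewrite (@fsum_nat _ _ _ (fun j : nat => (- l - 1, j%:Z, l - j%:Z)) K).
- apply: eq_bigr => j _.
  rewrite /delta_021 /delta3 /subpow /YY21 /Yser /= subrr eqxx.
  have -> : - (- l - 1) - 1 = l by ring.
  rewrite subrK eqxx; congr (_ *: Y _ _ (Y _ _ _)); last 2 first.
  + by ring.
  + by ring.
  rewrite -mulNr; congr (_ * _).
  rewrite exprzDr ?unitrN1 // -[- l]mulN1r -exprz_exp exprN1 invrN1.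
  by rewrite mulrN1 opprK.
- by move=> i j [].
move=> [[k0 k1] k2] /=.
rewrite /delta_021 /delta3 /subpow /YY21 /Yser /=.
case: (eqVneq (- l - 1 - k0) 0) => [k0E|_]; last by rewrite scaler0 eqxx.
case: (k2 + k1 =P _) => [k12|_]; last by rewrite mulr0 oppr0 scale0r eqxx.
case: k1 k12 => k1 k12; last by rewrite /onepz !mulr0 oppr0 scale0r eqxx.
have uE : - (- m - 1 - k1%:Z) - 1 = m + k1%:Z by ring.
rewrite uE; case: (ltnP k1 K) => [k1K _|Kk1]; last first.
  by rewrite uw0 // Y0r scaler0 eqxx.
by exists k1 => //; congr (_, _, _); lia.
Qed.

Lemma series_mul_YY02 u v w (l m n : int) K :
    (forall j, (K <= j)%N -> Y u (l + j%:Z) v = 0) ->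
  series_mul (@delta_210 F) (YY02 Y u v w) (- l - 1, - m - 1, - n - 1)
  = \sum_(j < K) B m%:~R j *: Y (Y u (l + j%:Z) v) (m + n - j%:Z) w.
Proof.
move=> uv0; rewrite /series_mul.
rewrite (@fsum_nat _ _ _ (fun j : nat => (j%:Z, - m - 1, m - j%:Z)) K).
- apply: eq_bigr => j _.
  rewrite /delta_210 /delta3 /subpow /YY02 /Yser /= subrr eqxx.
  have -> : - m - 1 + j%:Z = - (m - j%:Z) - 1 by ring.
  rewrite eqxx; congr (_ *: Y (Y _ _ _) _ _); last 2 first.
  + by ring.
  + by ring.
  (* (-1)^j C(j - m - 1, j) is the coefficient of x1^(-m-1) x0^j in
     (x1 - x0)^(j-m-1) *)
  rewrite [RHS]binomialF_upper_neg; congr (_ * B _%:~R _); ring.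
- by move=> i j [].
move=> [[k0 k1] k2] /=.
rewrite /delta_210 /delta3 /subpow /YY02 /Yser /=.
case: (eqVneq (- m - 1 - k1) 0) => [k1E|_]; last by rewrite scaler0 eqxx.
case: (k1 + k0 =P _) => [k12|_]; last by rewrite scale0r eqxx.
case: k0 k12 => k0 k12; last by rewrite /onepz mulr0 scale0r eqxx.
have uE : - (- l - 1 - k0%:Z) - 1 = l + k0%:Z by ring.
rewrite uE; case: (ltnP k0 K) => [k0K _|Kk0]; last first.
  by rewrite uv0 // Y0l scaler0 eqxx.
by exists k0 => //; congr (_, _, _); lia.
Qed.

(** The Jacobi identity at [x0^(-l-1) x1^(-m-1) x2^(-n-1)]; the bound [K] is
    past the last nonzero term of each of the three sums. *)
Lemma Borcherds_identity i j u v w (l m n : int) K : jacobi Y i j u v ->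
    (forall t, (K <= t)%N -> Y u (l + t%:Z) v = 0) ->
    (forall t, (K <= t)%N -> Y u (m + t%:Z) w = 0) ->
    (forall t, (K <= t)%N -> Y v (n + t%:Z) w = 0) ->
  \sum_(t < K) B m%:~R t *: Y (Y u (l + t%:Z) v) (m + n - t%:Z) w
  = \sum_(t < K) ((-1) ^+ t * B l%:~R t) *:
      (Y u (m + l - t%:Z) (Y v (n + t%:Z) w)
       - ((-1) ^+ (i && j) * (-1) ^ l) *:
           Y v (n + l - t%:Z) (Y u (m + t%:Z) w)).
Proof.
move=> jac uv0 uw0 vw0.
have := jac w (- l - 1, - m - 1, - n - 1).
rewrite (@series_mul_YY12 u v w l m n K vw0).
rewrite (@series_mul_YY21 u v w l m n K uw0).
rewrite (@series_mul_YY02 u v w l m n K uv0).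
move=> <-; rewrite scaler_sumr -sumrB; apply: eq_bigr => t _.
rewrite scalerBr !scalerA; congr (_ - _ *: _).
by ring.
Qed.

End Borcherds.

(** * The Jacobi identity on residues *)

Section FiniteSums.
Variables (F : fieldType) (V : lmodType F).

Lemma linear_zero (U : lmodType F) (f : V -> U) : linear f -> f 0 = 0.
Proof.
move=> f_lin; have := f_lin 1 0 0; rewrite !scale1r addr0.
by move/eqP; rewrite -subr_eq subrr => /eqP.
Qed.

Lemma linear_scale (U : lmodType F) (f : V -> U) a u :
  linear f -> f (a *: u) = a *: f u.
Proof.
by move=> f_lin; rewrite -[a *: u]addr0 f_lin (linear_zero f_lin) addr0.
Qed.

Lemma linear_lincomb (U : lmodType F) (f : V -> U) (I : Type) (r : seq I)
    (P : pred I) (c : I -> F) (x : I -> V) : linear f ->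
  f (\sum_(i <- r | P i) c i *: x i) = \sum_(i <- r | P i) c i *: f (x i).
Proof.
move=> f_lin; elim: r => [|i r IH]; first by rewrite !big_nil linear_zero.
by rewrite !big_cons; case: ifP; rewrite ?f_lin IH.
Qed.

(** Both sides are the sum of the [f n] over all [n >= l]. *)
Lemma sum_shift (f : nat -> V) l K : (forall n, (K <= n)%N -> f n = 0) ->
  \sum_(k < K) f (k + l)%N = \sum_(n < K | (l <= n)%N) f n.
Proof.
move=> f0.
have -> : \sum_(k < K) f (k + l)%N = \sum_(l <= n < K + l) f n.
  by rewrite -{2}[l]add0n big_addn addnK big_mkord.
have -> : \sum_(n < K | (l <= n)%N) f n = \sum_(n < K + l | (l <= n)%N) f n.
  rewrite -!(big_mkord (fun n => (l <= n)%N)) [RHS](big_cat_nat (n := K)) //=.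
    rewrite [X in _ = _ + X]big_nat_cond [X in _ = _ + X]big1 ?addr0 //.
    by move=> n /andP[/andP[Kn _] _]; apply: f0.
  by rewrite leq_addr.
rewrite -(big_mkord (fun n => (l <= n)%N)).
rewrite [RHS](big_cat_nat (n := l)) ?leq_addl //=.
rewrite [X in _ = X + _]big_nat_cond [X in _ = X + _]big1 ?add0r; last first.
  by move=> n /andP[/andP[_ nl]]; rewrite leqNgt nl.
rewrite big_nat [RHS]big_nat_cond; apply: eq_bigl => n.
by case: (l <= n)%N; rewrite ?andbT.
Qed.

Lemma sum_convolution (c d : nat -> F) (G : nat -> V) K :
    (forall n, (K <= n)%N -> G n = 0) ->
  \sum_(i < K) \sum_(k < K) (c i * d k) *: G (i + k)%N
  = \sum_(n < K) (\sum_(i < n.+1) c i * d (n - i)%N) *: G n.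
Proof.
move=> G0.
transitivity
  (\sum_(i < K) \sum_(n < K | (i <= n)%N) (c i * d (n - i)%N) *: G n).
  apply: eq_bigr => i _.
  rewrite -(@sum_shift (fun n => (c i * d (n - i)%N) *: G n)); last first.
    by move=> n Kn; rewrite G0 // scaler0.
  by apply: eq_bigr => k _; rewrite addnK addnC.
rewrite (exchange_big_dep xpredT) //=; apply: eq_bigr => n _.
rewrite scaler_suml (big_ord_widen K (fun i => (c i * d (n - i)%N) *: G n)) //.
Qed.

Lemma sum_exchange3 K (c : 'I_K -> 'I_K -> F) (f : 'I_K -> 'I_K -> 'I_K -> V) :
  \sum_(x < K) \sum_(y < K) c x y *: \sum_(t < K) f x y t
  = \sum_(t < K) \sum_(x < K) \sum_(y < K) c x y *: f x y t.
Proof.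
rewrite [RHS]exchange_big; apply: eq_bigr => x _.
rewrite [RHS]exchange_big; apply: eq_bigr => y _.
by rewrite scaler_sumr.
Qed.

End FiniteSums.

Section Residues.
Variables (F : fieldType) (V : lmodType F) (S : vertex_superalgebra V).

Local Notation B := (binomialF F).
Local Notation Y := (mode S).

Lemma mode0l n v : Y 0 n v = 0.
Proof. exact: (linear_zero (mode_linear_l S n v)). Qed.

Lemma mode0r u n : Y u n 0 = 0.
Proof. exact: (linear_zero (mode_linear_r S u n)). Qed.

Lemma modeZl a u n v : Y (a *: u) n v = a *: Y u n v.
Proof. exact: (linear_scale a u (mode_linear_l S n v)). Qed.

Lemma modeZr a u n v : Y u n (a *: v) = a *: Y u n v.
Proof. exact: (linear_scale a v (mode_linear_r S u n)). Qed.

Lemma mode_truncation_nat u v (s : int) :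
  exists K : nat, forall i, (K <= i)%N -> Y u (i%:Z - s) v = 0.
Proof.
have [N uv0] := mode_truncation S u v.
by exists (`|N| + `|s|)%N => i Ki; apply: uv0; lia.
Qed.

(** A common bound for finitely many pairs of vectors. *)
Lemma mode_truncation_uniform (u v : nat -> V) J :
  exists N : nat, forall j, (j < J)%N -> forall n : int, N%:Z <= n ->
    Y (u j) n (v j) = 0.
Proof.
elim: J => [|J [N uv0]]; first by exists 0%N.
have [M uvJ] := mode_truncation S (u J) (v J).
exists (N + `|M|)%N => j; rewrite ltnS leq_eqVlt => /orP[/eqP -> n Nn|jJ n Nn].
  by apply: uvJ; lia.
by apply: uv0 => //; lia.
Qed.

(** [Res_z (1 + z)^alpha z^(- s) Y(u, z) v] for an integral exponent [s]. *)
Definition Res_pow (alpha : rat) (s : int) u v : V :=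
  Res (series_mul (shift (- s) (onepz F alpha)) (Yser Y u v)).

Lemma Res_powE a s u v K :
    (forall i, (K <= i)%N -> Y u (i%:Z - s) v = 0) ->
  Res_pow a s u v = \sum_(i < K) B a i *: Y u (i%:Z - s) v.
Proof.
move=> uv0; rewrite /Res_pow /Res /series_mul /shift /Yser.
rewrite (@fsum_nat _ _ _ (fun i : nat => i%:Z - s) K).
- apply: eq_bigr => i _; rewrite opprK subrK /=; congr (_ *: Y _ _ _).
  by ring.
- by move=> i j /addIr [].
move=> k; rewrite opprK.
have -> : - (-1 - k) - 1 = k by ring.
case ks : (k + s) => [i|i]; last by rewrite /onepz scale0r eqxx.
have -> : k = i%:Z - s by rewrite -ks addrK.
by case: (ltnP i K) => [iK _|Ki]; [exists i | rewrite uv0 // scaler0 eqxx].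
Qed.

Lemma Res_pow_truncated a s u v :
  exists K0, forall K, (K0 <= K)%N ->
    Res_pow a s u v = \sum_(i < K) B a i *: Y u (i%:Z - s) v.
Proof.
have [K uv0] := mode_truncation_nat u v s.
by exists K => L KL; apply: Res_powE => i Li; apply: uv0; apply: leq_trans Li.
Qed.

Lemma Res_pow_linear_r a s u : linear (Res_pow a s u).
Proof.
move=> c v w.
have [K0 H0] := Res_pow_truncated a s u v.
have [K1 H1] := Res_pow_truncated a s u w.
have [K2 H2] := Res_pow_truncated a s u (c *: v + w).
set K := (K0 + K1 + K2)%N.
rewrite (H0 K) ?(H1 K) ?(H2 K) /K; try lia.
rewrite scaler_sumr -big_split; apply: eq_bigr => i _ /=.
by rewrite mode_linear_r scalerDr !scalerA mulrC.
Qed.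

Lemma Res_pow_linear_l a s v : linear (Res_pow a s ^~ v).
Proof.
move=> c u w.
have [K0 H0] := Res_pow_truncated a s u v.
have [K1 H1] := Res_pow_truncated a s w v.
have [K2 H2] := Res_pow_truncated a s (c *: u + w) v.
set K := (K0 + K1 + K2)%N.
rewrite (H0 K) ?(H1 K) ?(H2 K) /K; try lia.
rewrite scaler_sumr -big_split; apply: eq_bigr => i _ /=.
by rewrite mode_linear_l scalerDr !scalerA mulrC.
Qed.

Lemma Res_pow0r a s u : Res_pow a s u 0 = 0.
Proof. exact: (linear_zero (Res_pow_linear_r a s u)). Qed.

Lemma Res_pow0l a s v : Res_pow a s 0 v = 0.
Proof. exact: (linear_zero (Res_pow_linear_l a s v)). Qed.

Lemma Res_pow_vac_l a v : Res_pow a 1 (vac S) v = v.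
Proof.
rewrite (@Res_powE _ _ _ _ 1); last first.
  by move=> t t1; rewrite mode_vac; case: eqP => //; lia.
by rewrite big_ord1 binomialF0 scale1r mode_vac.
Qed.

Lemma Res_pow_vac_r a v : Res_pow a 1 v (vac S) = v.
Proof.
rewrite (@Res_powE _ _ _ _ 1); last first.
  by move=> [|t] // _; rewrite mode_creation //; lia.
by rewrite big_ord1 binomialF0 scale1r mode_creation1.
Qed.

Variables (p : nat) (p_char : p \in [pchar F]).
Local Notation D := (p_integral p).

(** [(1 + z)^(a + 1) = (1 + z)^a + z (1 + z)^a]. *)
Lemma Res_pow_Pascal a s u v : a \in D ->
  Res_pow (a + 1) s u v = Res_pow a s u v + Res_pow a (s - 1) u v.
Proof.
move=> aD.
have [K0 H0] := Res_pow_truncated (a + 1) s u v.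
have [K1 H1] := Res_pow_truncated a s u v.
have [K2 H2] := Res_pow_truncated a (s - 1) u v.
set K := (K0 + K1 + K2)%N.
rewrite (H0 K.+1) ?(H1 K.+1) ?(H2 K) /K; try lia.
rewrite !big_ord_recl !binomialF0 -addrA; congr (_ + _).
rewrite -big_split; apply: eq_bigr => i _ /=.
rewrite /bump leq0n add1n (binomialF_Pascal p_char) // scalerDl.
by congr (_ + _ *: Y _ _ _); lia.
Qed.

(** The Jacobi identity multiplied by
    [x0^(- s0) x1^(- s1) (1 + x1)^al x2^(- s2) (1 + x2)^be], in residues. On
    the left, [x1^(- s1) (1 + x1)^al] is expanded at [x1 = x2 + x0] in powers
    of [x0]: the coefficient of [x0^t] is the sum over [l <= t] of
    [C(al, l) C(- s1, t - l) (1 + x2)^(al - l) x2^(- s1 - t + l)]. All the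
    sums are finite, and they may be cut at any large enough [K]. *)
Lemma Res_Jacobi i j a b w (s0 s1 s2 : int) al be :
    al \in D -> be \in D -> a \in parity S i -> b \in parity S j ->
  exists K0, forall K, (K0 <= K)%N ->
  \sum_(t < K) \sum_(l < t.+1) (B (- s1)%:~R (t - l) * B al l) *:
     Res_pow (al - l%:R + be) (s1 + s2 + t%:Z - l%:Z) (Y a (t%:Z - s0) b) w
  = \sum_(t < K) ((-1) ^+ t * B (- s0)%:~R t) *:
     (Res_pow al (s1 + s0 + t%:Z) a (Res_pow be (s2 - t%:Z) b w)
      - ((-1) ^+ (i && j) * (-1) ^ (- s0)) *:
          Res_pow be (s2 + s0 + t%:Z) b (Res_pow al (s1 - t%:Z) a w)).
Proof.
move=> alD beD ai bj.
have [J0 ab0] := mode_truncation_nat a b s0.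
have [J1 aw0] := mode_truncation_nat a w s1.
have [J2 bw0] := mode_truncation_nat b w s2.
pose J := (J0 + J1 + J2)%N.
have [N0 abw0] :=
  mode_truncation_uniform (fun y => Y a (y%:Z - s0) b) (fun=> w) J.
have [N1 baw0] :=
  mode_truncation_uniform (fun=> b) (fun y => Y a (y%:Z - s1) w) J.
have [N2 abw1] :=
  mode_truncation_uniform (fun=> a) (fun y => Y b (y%:Z - s2) w) J.
(* Past this bound every mode in sight vanishes: J bounds the inner modes, and
   the outer modes on the finitely many remaining values are bounded by the
   N's, up to shifts by s0, s1, s2 and J *)
exists (J + N0 + N1 + N2 + `|s0| + `|s1| + `|s2|)%N => K K0K.
have jac := mode_jacobi ai bj.
(* Both sides are combinations of the Borcherds identities with l = - s0,
   m = x - s1 and n = y - s2, weighted by C(al, x) C(be, y) *)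
transitivity (\sum_(x < K) \sum_(y < K) (B al x * B be y) *:
   \sum_(t < K) B (x%:Z - s1)%:~R t *:
     Y (Y a (- s0 + t%:Z) b) ((x%:Z - s1) + (y%:Z - s2) - t%:Z) w); last first.
  transitivity (\sum_(x < K) \sum_(y < K) (B al x * B be y) *:
   \sum_(t < K) ((-1) ^+ t * B (- s0)%:~R t) *:
      (Y a ((x%:Z - s1) + (- s0) - t%:Z) (Y b ((y%:Z - s2) + t%:Z) w)
       - ((-1) ^+ (i && j) * (-1) ^ (- s0)) *:
           Y b ((y%:Z - s2) + (- s0) - t%:Z) (Y a ((x%:Z - s1) + t%:Z) w))).
    apply: eq_bigr => x _; apply: eq_bigr => y _; congr (_ *: _).
    apply: (Borcherds_identity mode0l mode0r jac) => t Kt.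
    - by rewrite addrC ab0 //; lia.
    - have -> : x%:Z - s1 + t%:Z = (x + t)%N%:Z - s1 by lia.
      by apply: aw0; lia.
    - have -> : y%:Z - s2 + t%:Z = (y + t)%N%:Z - s2 by lia.
      by apply: bw0; lia.
  rewrite sum_exchange3.
  apply: eq_bigr => t _.
  have -> : Res_pow al (s1 + s0 + t%:Z) a (Res_pow be (s2 - t%:Z) b w)
      = \sum_(x < K) \sum_(y < K) (B al x * B be y) *:
          Y a ((x%:Z - s1) + (- s0) - t%:Z) (Y b ((y%:Z - s2) + t%:Z) w).
    rewrite (@Res_powE be _ _ _ K); last first.
      move=> y Ky; have -> : y%:Z - (s2 - t%:Z) = (y + t)%N%:Z - s2 by lia.
      by apply: bw0; lia.
    rewrite linear_lincomb; last exact: Res_pow_linear_r.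
    rewrite exchange_big; apply: eq_bigr => y _ /=.
    have yE : y%:Z - (s2 - t%:Z) = (y + t)%N%:Z - s2 by lia.
    have yE' : y%:Z - s2 + t%:Z = (y + t)%N%:Z - s2 by lia.
    rewrite yE yE' (@Res_powE al _ _ _ K); last first.
      move=> x Kx; case: (ltnP (y + t) J) => [ytJ|Jyt].
        by apply: (abw1 _ ytJ); lia.
      by rewrite bw0 ?mode0r //; lia.
    rewrite scaler_sumr; apply: eq_bigr => x _.
    rewrite scalerA mulrC; congr (_ *: Y _ _ _); lia.
  have -> : Res_pow be (s2 + s0 + t%:Z) b (Res_pow al (s1 - t%:Z) a w)
      = \sum_(x < K) \sum_(y < K) (B al x * B be y) *:
          Y b ((y%:Z - s2) + (- s0) - t%:Z) (Y a ((x%:Z - s1) + t%:Z) w).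
    rewrite (@Res_powE al _ _ _ K); last first.
      move=> x Kx; have -> : x%:Z - (s1 - t%:Z) = (x + t)%N%:Z - s1 by lia.
      by apply: aw0; lia.
    rewrite linear_lincomb; last exact: Res_pow_linear_r.
    apply: eq_bigr => x _ /=.
    have xE : x%:Z - (s1 - t%:Z) = (x + t)%N%:Z - s1 by lia.
    have xE' : x%:Z - s1 + t%:Z = (x + t)%N%:Z - s1 by lia.
    rewrite xE xE' (@Res_powE be _ _ _ K); last first.
      move=> y Ky; case: (ltnP (x + t) J) => [xtJ|Jxt].
        by apply: (baw0 _ xtJ); lia.
      by rewrite aw0 ?mode0r //; lia.
    rewrite scaler_sumr; apply: eq_bigr => y _.
    rewrite scalerA; congr (_ *: Y _ _ _); lia.
  rewrite scaler_sumr -sumrB scaler_sumr; apply: eq_bigr => x _.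
  rewrite scaler_sumr -sumrB scaler_sumr; apply: eq_bigr => y _.
  rewrite !scalerBr !scalerA; congr (_ *: _ - _ *: _); ring.
rewrite sum_exchange3.
apply: eq_bigr => t _.
pose G n := Y (Y a (t%:Z - s0) b) (n%:Z - s1 - s2 - t%:Z) w.
have G0 n : (K <= n)%N -> G n = 0.
  move=> Kn; rewrite /G; case: (ltnP t J) => [tJ|Jt].
    by apply: (abw0 _ tJ); lia.
  by rewrite ab0 ?mode0l //; lia.
(* Vandermonde splits C(x - s1, t) into the sum of the C(x, l) C(- s1, t - l) *)
transitivity (\sum_(l < t.+1) B (- s1)%:~R (t - l) *:
   \sum_(x < K) \sum_(y < K) (B al x * 'C(x, l)%:R * B be y) *: G (x + y)%N).
  apply: eq_bigr => l _; rewrite -scalerA; congr (_ *: _).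
  rewrite (@sum_convolution _ _ (fun x => B al x * 'C(x, l)%:R)) //.
  rewrite (@Res_powE _ _ _ _ K); last first.
    move=> n Kn; rewrite -(G0 (n + l)%N) ?/G; last by lia.
    by congr (Y _ _ _); lia.
  transitivity
    (B al l *: \sum_(n < K) B (al - l%:R + be) (n + l - l) *: G (n + l)%N).
    congr (_ *: _); apply: eq_bigr => n _; rewrite addnK; congr (_ *: Y _ _ _).
    by lia.
  rewrite (@sum_shift _ _ (fun n => B (al - l%:R + be) (n - l) *: G n));
    last by move=> n Kn; rewrite G0 // scaler0.
  rewrite scaler_sumr big_mkcond; apply: eq_bigr => n _.
  rewrite (binomialF_convolution p_char) //.
  by case: ifP => _; rewrite ?scale0r // scalerA.
under eq_bigr do rewrite scaler_sumr.
rewrite exchange_big; apply: eq_bigr => x _ /=.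
under eq_bigr do rewrite scaler_sumr.
rewrite exchange_big; apply: eq_bigr => y _ /=.
have -> : (x%:Z - s1)%:~R = x%:R + (- s1)%:~R :> rat by rewrite intrD.
rewrite -(binomialF_Vandermonde p_char) ?rpred_nat ?rpred_int //.
rewrite scalerA mulr_sumr scaler_suml; apply: eq_bigr => l _.
rewrite scalerA binomialF_nat /G; congr (_ *: Y (Y _ _ _) _ _).
- by ring.
- by rewrite addrC.
- by lia.
Qed.

Let B0S t : B (- 0%Z)%:~R t.+1 = 0.
Proof. by rewrite -[_%:~R]/(0%:R) binomialF_nat bin0n. Qed.

(** The commutator formula, which is the case [s0 = 0]: on the right only the
    term [t = 0] remains. The sign [c] is left unspecified. *)
Lemma Res_commutator i j a b w (s1 s2 : int) al be :
    al \in D -> be \in D -> a \in parity S i -> b \in parity S j ->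
  exists K c,
    Res_pow al s1 a (Res_pow be s2 b w)
    = c *: Res_pow be s2 b (Res_pow al s1 a w)
      + \sum_(t < K) \sum_(l < t.+1) (B (- s1)%:~R (t - l) * B al l) *:
          Res_pow (al - l%:R + be) (s1 + s2 + t%:Z - l%:Z) (Y a t%:Z b) w.
Proof.
move=> alD beD ai bj.
have [K HK] := Res_Jacobi w 0 s1 s2 alD beD ai bj.
exists K.+1, ((-1) ^+ (i && j) * (-1) ^ (- 0)).
have := HK K.+1 (leqnSn K).
rewrite [X in _ = X]big_ord_recl [X in _ = _ + X]big1.
  rewrite /= -![Posz 0]/(0%R : int).
  rewrite addr0 binomialF0 mulr1 scale1r !addr0 => eqK.
  rewrite -[LHS](subrK (((-1) ^+ (i && j) * (-1) ^ (- 0)) *: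
    Res_pow be s2 b (Res_pow al s1 a w))) -eqK addrC; congr (_ + _).
  apply: eq_bigr => t _; apply: eq_bigr => l _.
  by rewrite subr0.
by move=> t _; rewrite /= /bump leq0n add1n B0S mulr0 scale0r.
Qed.

(** The iterate formula, which is the case [s1 = 0]: on the left only the
    terms [l = t] remain. *)
Lemma Res_iterate i j a b w (s0 s2 : int) al be :
    al \in D -> be \in D -> a \in parity S i -> b \in parity S j ->
  exists K0 c, forall K, (K0 <= K)%N ->
  \sum_(t < K) B al t *: Res_pow (al - t%:R + be) s2 (Y a (t%:Z - s0) b) w
  = \sum_(t < K) ((-1) ^+ t * B (- s0)%:~R t) *:
     (Res_pow al (s0 + t%:Z) a (Res_pow be (s2 - t%:Z) b w)
      - c *: Res_pow be (s2 + s0 + t%:Z) b (Res_pow al (- t%:Z) a w)).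
Proof.
move=> alD beD ai bj.
have [K0 HK] := Res_Jacobi w s0 0 s2 alD beD ai bj.
exists K0, ((-1) ^+ (i && j) * (-1) ^ (- s0)) => K /HK eqK.
transitivity (\sum_(t < K) ((-1) ^+ t * B (- s0)%:~R t) *:
     (Res_pow al (0 + s0 + t%:Z) a (Res_pow be (s2 - t%:Z) b w)
      - ((-1) ^+ (i && j) * (-1) ^ (- s0)) *:
          Res_pow be (s2 + s0 + t%:Z) b (Res_pow al (0 - t%:Z) a w)));
  last by apply: eq_bigr => t _; rewrite !add0r.
rewrite -eqK; apply: eq_bigr => t _.
rewrite big_ord_recr big1 /= ?add0r.
  by rewrite subnn binomialF0 mul1r addrK.
move=> l _.
have -> : (t - l = (t - l).-1.+1)%N by have := ltn_ord l; lia.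
by rewrite B0S mul0r scale0r.
Qed.

End Residues.

(** * Direct sums *)

Section DirectSum.
Variables (F : fieldType) (V : lmodType F) (I : choiceType).

Lemma fsum_seq (U : zmodType) (r : seq I) (c : I -> U) :
    uniq r -> (forall i, c i != 0 -> i \in r) ->
  \sum_(i \in [set: I]) c i = \sum_(i <- r) c i.
Proof.
move=> r_uniq cr; rewrite (fsbigE r) //.
  by apply: eq_bigl => i; rewrite in_setT.
by move=> i _; apply: contraNeq => /cr.
Qed.

Lemma finite_support_seq (U : zmodType) (c : I -> U) :
    finite_set [set i | c i != 0]%classic ->
  exists2 r : seq I, uniq r & forall i, c i != 0 -> i \in r.
Proof.
move=> /finite_seqP[s sE]; exists (undup s); first exact: undup_uniq.
move=> i ci; rewrite mem_undup.
by have : [set i | c i != 0]%classic i by []; rewrite sE.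
Qed.

Lemma seq_finite_support (U : zmodType) (r : seq I) (c : I -> U) :
  (forall i, c i != 0 -> i \in r) -> finite_set [set i | c i != 0]%classic.
Proof.
by move=> cr; apply: (sub_finite_set _ (finite_seq r)) => i /cr.
Qed.

Variables (W : I -> {pred V}) (U : {pred V}) (W_direct : is_direct_sum W U).

Let W0 i : 0 \in W i.
Proof. by have [Wsub _ _] := W_direct; have [] := Wsub i. Qed.

Lemma decomposition_homog i v : v \in W i ->
  decomposition W v (fun j => if j == i then v else 0).
Proof.
move=> vi; have supp j : (if j == i then v else 0) != 0 -> j \in [:: i].
  by rewrite inE; case: (j == i); rewrite ?eqxx.
split; first exact: seq_finite_support supp.
  by move=> j; case: (eqVneq j i) => [->|_].
by rewrite (fsum_seq (r := [:: i])) // big_seq1 eqxx.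
Qed.

Lemma direct_sum_sub i v : v \in W i -> v \in U.
Proof.
move=> vi; have [_ WU _] := W_direct; apply/WU.
by exists (fun j => if j == i then v else 0); exact: decomposition_homog.
Qed.

(** [component] is a choice among the decompositions of [v]; there is only
    one. *)
Lemma component_unique v c : decomposition W v c -> component W v = c.
Proof.
move=> vc; have [_ _ W_uniq] := W_direct; apply: (W_uniq v) => //.
exact: (xgetPex _ (ex_intro _ c vc)).
Qed.

Lemma component_homog i v : v \in W i ->
  component W v = (fun j => if j == i then v else 0).
Proof. by move=> vi; apply/component_unique/decomposition_homog. Qed.

Lemma linear_extension_homog (Z : lmodType F) (f : I -> V -> Z) i v :
  (forall j, f j 0 = 0) -> v \in W i -> linear_extension W f v = f i v.
Proof.
move=> f0 vi; rewrite /linear_extension (component_homog vi).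
rewrite (fsum_seq (r := [:: i])) // ?big_seq1 ?eqxx // => j.
by rewrite inE; case: (j == i); rewrite // f0 eqxx.
Qed.

Lemma component_decomposition v : v \in U -> decomposition W v (component W v).
Proof.
have [_ WU _] := W_direct; move=> /WU[c vc].
exact: (xgetPex _ (ex_intro _ c vc)).
Qed.

Lemma component_in v i : v \in U -> component W v i \in W i.
Proof. by move=> /component_decomposition[_ + _]; apply. Qed.

Lemma component_support v : v \in U ->
  exists r : seq I, [/\ uniq r, forall i, component W v i != 0 -> i \in r
                     & v = \sum_(i <- r) component W v i].
Proof.
move=> /component_decomposition[/finite_support_seq[r r_uniq vr] _ vE].
by exists r; split=> //; rewrite {1}vE (fsum_seq (r := r)).
Qed.

Lemma direct_sum_ind (P : V -> Prop) :
    P 0 -> (forall u v, P u -> P v -> P (u + v)) ->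
    (forall i v, v \in W i -> P v) ->
  forall v, v \in U -> P v.
Proof.
move=> P0 PD PW v vU; have [r [_ _ ->]] := component_support vU.
by elim/big_ind: _ => // i _; apply: (PW i); apply: component_in.
Qed.

End DirectSum.

Section DirectSumT.
Variables (F : fieldType) (V : lmodType F) (I : choiceType).
Variables (W : I -> {pred V}) (W_direct : is_direct_sum W predT).

Lemma component_linear a u v i :
  component W (a *: u + v) i = a *: component W u i + component W v i.
Proof.
have [ru [ru_uniq ruP uE]] := component_support W_direct (isT : u \in predT).
have [rv [rv_uniq rvP vE]] := component_support W_direct (isT : v \in predT).
rewrite (component_unique W_direct
  (c := fun i => a *: component W u i + component W v i)) //.
have cW x j : component W x j \in W j by exact: (component_in W_direct).
have supp j : a *: component W u j + component W v j != 0 ->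
    j \in undup (ru ++ rv).
  rewrite mem_undup mem_cat; apply: contraR; rewrite negb_or => /andP[ju jv].
  rewrite (contraNeq (ruP j) ju) (contraNeq (rvP j) jv).
  by rewrite scaler0 addr0.
have [Wsub _ _] := W_direct; split.
- exact: seq_finite_support supp.
- by move=> j; have [_] := Wsub j; apply.
rewrite (fsum_seq _ supp) ?undup_uniq // big_split -scaler_sumr /=.
rewrite -(@fsum_seq _ _ (undup (ru ++ rv)) (component W u)) ?undup_uniq //;
  last by move=> j /ruP; rewrite mem_undup mem_cat => ->.
rewrite -(@fsum_seq _ _ (undup (ru ++ rv)) (component W v)) ?undup_uniq //;
  last by move=> j /rvP; rewrite mem_undup mem_cat orbC => ->.
have fsumE x : \sum_(i \in [set: I]) component W x i = x.
  by have [_ _ <-] := component_decomposition W_direct (isT : x \in predT).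
by rewrite !fsumE.
Qed.

Lemma linear_extension_linear (Z : lmodType F) (f : I -> V -> Z) :
  (forall i, linear (f i)) -> linear (linear_extension W f).
Proof.
move=> f_lin a u v.
have f0 i : f i 0 = 0 by exact: linear_zero (f_lin i).
have [ru [_ ruP _]] := component_support W_direct (isT : u \in predT).
have [rv [_ rvP _]] := component_support W_direct (isT : v \in predT).
set r := undup (ru ++ rv).
have r_uniq : uniq r by exact: undup_uniq.
have ur i : component W u i != 0 -> i \in r.
  by move=> /ruP; rewrite mem_undup mem_cat => ->.
have vr i : component W v i != 0 -> i \in r.
  by move=> /rvP; rewrite mem_undup mem_cat orbC => ->.
rewrite /linear_extension.
rewrite !(@fsum_seq _ _ r) //.
- rewrite scaler_sumr -big_split; apply: eq_bigr => i _ /=.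
  by rewrite component_linear f_lin.
- by move=> i; apply: contraR => /(contraNeq (vr i)) ->; rewrite f0.
- by move=> i; apply: contraR => /(contraNeq (ur i)) ->; rewrite f0.
move=> i; apply: contraR => ir; rewrite component_linear.
by rewrite (contraNeq (ur i) ir) (contraNeq (vr i) ir) scaler0 addr0 f0.
Qed.

(** Linearity in a parameter of the family. *)
Lemma linear_extension_param (Z U : lmodType F) (f : I -> V -> U -> Z) u :
    (forall i v, linear (f i v)) -> (forall i x, f i 0 x = 0) ->
  linear (fun x => linear_extension W (fun i v => f i v x) u).
Proof.
move=> f_lin f0 a x y; rewrite /linear_extension.
have [r [r_uniq rP _]] := component_support W_direct (isT : u \in predT).
have supp z i : f i (component W u i) z != 0 -> i \in r.
  by apply: contraR => /(contraNeq (rP i)) ->; rewrite f0.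
rewrite !(fsum_seq r_uniq) //; try exact: supp.
by rewrite scaler_sumr -big_split; apply: eq_bigr => i _ /=; rewrite f_lin.
Qed.

End DirectSumT.

(** * Eigenspaces of an operator of finite order *)

Section Eigenspaces.
Variables (F : fieldType) (V : lmodType F) (h : V -> V) (h_lin : linear h).
Variables (n : nat) (eps : F) (eps_prim : n.-primitive_root eps).
Hypothesis hn : iter n h =1 id.

Let n_gt0 : (0 < n)%N := prim_order_gt0 eps_prim.

Lemma sum_root_of_unity (x : F) : x ^+ n = 1 ->
  \sum_(j < n) x ^+ j = if x == 1 then n%:R else 0.
Proof.
move=> xn; case: eqP => [->|/eqP x1].
  under eq_bigr do rewrite expr1n.
  by rewrite sumr_const card_ord.
apply/eqP; move: (subrX1 x n); rewrite xn subrr => /esym/eqP.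
by rewrite mulf_eq0 subr_eq0 (negPf x1).
Qed.

(** The projection onto the eigenspace of [eps ^+ r]. *)
Definition eigenproj (r : nat) (v : V) : V :=
  n%:R^-1 *: \sum_(j < n) ((eps ^+ r)^-1) ^+ j *: iter j h v.

Let n_neq0 : n%:R != 0 :> F := prim_root_natf_neq0 eps_prim.

Let eps_neq0 r : eps ^+ r != 0.
Proof.
rewrite expf_neq0 //; apply/eqP => eps0; move: (prim_expr_order eps_prim).
by rewrite eps0 expr0n gtn_eqF // => /esym/eqP; rewrite oner_eq0.
Qed.

Lemma eigenproj_eigen r s v : h v = eps ^+ s *: v -> (r < n)%N -> (s < n)%N ->
  eigenproj r v = if s == r then v else 0.
Proof.
move=> hv rn sn; rewrite /eigenproj.
have itE j : iter j h v = (eps ^+ s) ^+ j *: v.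
  elim: j => [|j IH]; first by rewrite scale1r.
  by rewrite iterS IH (linear_scale _ _ h_lin) hv scalerA -exprSr.
under eq_bigr do rewrite itE scalerA -exprMn.
rewrite -scaler_suml sum_root_of_unity; last first.
  rewrite exprMn exprVn -!exprM !(mulnC _ n) !exprM.
  by rewrite (prim_expr_order eps_prim) !expr1n invr1 mulr1.
have -> : ((eps ^+ r)^-1 * eps ^+ s == 1) = (s == r).
  rewrite mulrC -[1](divff (eps_neq0 r)).
  rewrite (inj_eq (mulIf _)) ?invr_eq0 // (eq_prim_root_expr eps_prim).
  by rewrite !modn_small.
by case: eqP; rewrite ?scale0r ?scaler0 // scalerA mulVf // scale1r.
Qed.

Lemma eigenproj_in_eigen r v : h (eigenproj r v) = eps ^+ r *: eigenproj r v.
Proof.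
rewrite /eigenproj (linear_scale _ _ h_lin) (linear_lincomb _ _ _ _ h_lin).
rewrite scalerA mulrC -scalerA.
congr (_ *: _); case: n n_gt0 hn (prim_expr_order eps_prim) => // m _ hm epsm.
rewrite big_ord_recr big_ord_recl /= scalerDr expr0 scale1r addrC.
congr (_ + _).
  have -> : h (iter m h v) = v by exact: (hm v).
  congr (_ *: _); rewrite exprVn.
  apply: (mulfI (expf_neq0 m (eps_neq0 r))).
  rewrite mulfV ?(expf_neq0 m (eps_neq0 r)) //.
  by rewrite -exprSr -exprM mulnC exprM epsm expr1n.
rewrite scaler_sumr; apply: eq_bigr => j _.
rewrite scalerA -iterS; congr (_ *: _).
by rewrite exprS mulrA mulfV // mul1r.
Qed.

Lemma sum_eigenproj v : \sum_(r < n) eigenproj r v = v.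
Proof.
rewrite -scaler_sumr exchange_big /=.
transitivity
  (n%:R^-1 *: \sum_(j < n) (if (j : nat) == 0%N then n%:R *: v else 0)).
  congr (_ *: _); apply: eq_bigr => j _; rewrite -scaler_suml.
  under eq_bigr do rewrite -exprVn -exprM mulnC exprM.
  rewrite sum_root_of_unity; last first.
    rewrite -exprM mulnC exprM exprVn (prim_expr_order eps_prim).
    by rewrite invr1 expr1n.
  rewrite exprVn invr_eq1 -[1](expr0 eps) (eq_prim_root_expr eps_prim).
  rewrite modn_small // mod0n; case: eqP => [->|_] //.
  by rewrite scale0r.
rewrite (bigD1 (Ordinal n_gt0)) //= big1 ?addr0; last first.
  by move=> j j0; rewrite ifN.
by rewrite scalerA mulVf // scale1r.
Qed.

Lemma eigenproj_linear r : linear (eigenproj r).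
Proof.
have it_lin j : linear (iter j h).
  by elim: j => [|j IH] a u v //=; rewrite IH h_lin.
move=> a u v; rewrite /eigenproj !scaler_sumr -big_split; apply: eq_bigr => j _.
by rewrite /= it_lin !scalerDr !scalerA; congr (_ *: _ + _); ring.
Qed.

Lemma eigenproj_closed (W : {pred V}) r v : submod_closed W ->
  (forall u, u \in W -> h u \in W) -> v \in W -> eigenproj r v \in W.
Proof.
move=> [W0 Wlin] hW vW.
have WZ a u : u \in W -> a *: u \in W by move=> uW; rewrite -[_ *: _]addr0 Wlin.
have WD u x : u \in W -> x \in W -> u + x \in W.
  by move=> uW xW; rewrite -[u]scale1r Wlin.
apply: (WZ); elim/big_ind: _ => // j _; apply: (WZ).
by elim: (j : nat) => //= i; apply: hW.
Qed.

(** A direct sum of subspaces stable by [h] is refined by the eigenspaces. *)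
Lemma eigen_direct_sum (I : choiceType) (W : I -> {pred V}) :
    is_direct_sum W predT -> (forall i u, u \in W i -> h u \in W i) ->
  is_direct_sum (fun i : I * 'I_n =>
    [pred v | (v \in W i.1) && (h v == eps ^+ (i.2 : nat) *: v)]) predT.
Proof.
move=> W_direct hW; have [Wsub WU W_uniq] := W_direct.
have h0 : h 0 = 0 by exact: linear_zero h_lin.
set E := fun i => _.
have fsum_pairs (c : I * 'I_n -> V) (r : seq I) : uniq r ->
    (forall i, c i != 0 -> i.1 \in r) ->
    \sum_(i \in [set: I * 'I_n]) c i = \sum_(i <- r) \sum_(j < n) c (i, j).
  move=> r_uniq cr.
  rewrite (@fsum_seq _ _ [seq (i, j) | i <- r, j <- enum 'I_n]).
  - rewrite big_allpairs; apply: eq_bigr => i _.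
    by rewrite big_enum.
  - apply: allpairs_uniq => //; first exact: enum_uniq.
    by move=> [? ?] [? ?] _ _ [-> ->].
  - by move=> [i j] /cr /= ir; apply: allpairs_f; rewrite // mem_enum.
split.
- move=> [i r]; split.
    by rewrite !inE /= h0 scaler0 eqxx andbT; have [] := Wsub i.
  move=> a u v; rewrite !inE /= => /andP[ui /eqP hu] /andP[vi /eqP hv].
  have [_ ->] //= := Wsub i.
  by rewrite h_lin hu hv scalerDr !scalerA mulrC.
- move=> v; split=> // _.
  have [r [r_uniq rP vE]] := component_support W_direct (isT : v \in predT).
  pose c (i : I * 'I_n) := eigenproj i.2 (component W v i.1).
  have ep0 s : eigenproj s 0 = 0 by exact: linear_zero (eigenproj_linear s).
  have cP i : c i != 0 -> i.1 \in r.
    by apply: contraR => /(contraNeq (rP i.1)) ci; rewrite /c ci ep0.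
  exists c; split.
  + apply: (@seq_finite_support _ _ [seq (i, j) | i <- r, j <- enum 'I_n]).
    by move=> [i j] /cP /= ir; apply: allpairs_f; rewrite // mem_enum.
  + move=> [i s]; rewrite !inE /= /c /= eigenproj_in_eigen eqxx andbT.
    apply: eigenproj_closed => //; first exact: hW.
    exact: (component_in W_direct).
  + rewrite (fsum_pairs _ r) // {1}vE; apply: eq_bigr => i _.
    by rewrite /c /= sum_eigenproj.
move=> v c d; suff comp c' : decomposition E v c' ->
    c' = fun i => eigenproj i.2 (component W v i.1).
  by move=> /comp -> /comp ->.
move=> [/finite_support_seq[r r_uniq rP] cE vE].
pose r1 := undup [seq i.1 | i <- r].
have r1P i : c' i != 0 -> i.1 \in r1.
  by move=> /rP ir; rewrite mem_undup map_f.
have cW : component W v = fun i => \sum_(j < n) c' (i, j).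
  apply: (component_unique W_direct).
  have supp i : \sum_(j < n) c' (i, j) != 0 -> i \in r1.
    apply: contraR => ir; apply/eqP/big1 => j _.
    by apply: contraNeq ir => /r1P.
  split.
  + exact: seq_finite_support supp.
  + move=> i; have [Wi0 Wilin] := Wsub i.
    elim/big_ind: _ => // [u x uW xW|j _]; first by rewrite -[u]scale1r Wilin.
    by have := cE (i, j); rewrite !inE => /andP[].
  by rewrite vE (fsum_pairs _ r1) ?undup_uniq // (fsum_seq _ supp) ?undup_uniq.
apply: funext => -[i s] /=; rewrite cW.
have := linear_lincomb (index_enum 'I_n) xpredT (fun=> 1)
  (fun j => c' (i, j)) (eigenproj_linear s).
under eq_bigr do rewrite scale1r.
move=> ->; rewrite (bigD1 s) //= scale1r big1 ?addr0; last first.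
  move=> j js; rewrite (eigenproj_eigen (s := j)) // ?ifN ?scaler0 //.
  by have := cE (i, j); rewrite !inE => /andP[_ /eqP].
rewrite (eigenproj_eigen (s := s)) ?eqxx //.
by have := cE (i, s); rewrite !inE => /andP[_ /eqP].
Qed.

End Eigenspaces.

(** * The twisted Zhu algebra *)

Section Parity.
Variables (F : fieldType) (V : lmodType F) (S : half_graded V).

Lemma sigma_linear : linear (sigma S).
Proof.
apply: linear_extension_linear; first exact: parity_direct.
by move=> i a u v; rewrite scalerDr !scalerA mulrC.
Qed.

Lemma sigma_parity i v : v \in parity S i -> sigma S v = (-1) ^+ i *: v.
Proof.
move=> vi; rewrite /sigma (linear_extension_homog (parity_direct S) _ vi) //.
by move=> j; rewrite scaler0.
Qed.

Lemma grade_parity k v : v \in grade S k -> exists i, v \in parity S i.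
Proof.
have [n [->|->]] : exists n : int, k = 2 * n \/ k = 2 * n + 1.
  by exists (k %/ 2)%Z; lia.
- by move=> vk; exists false; exact: (direct_sum_sub (grade_even S) (i := n)).
- by move=> vk; exists true; exact: (direct_sum_sub (grade_odd S) (i := n)).
Qed.

Lemma degreeD k l : degree (k + l) = degree k + degree l.
Proof. by rewrite /degree intrD mulrDl. Qed.

Lemma degree2 k : degree (2 * k) = k%:~R.
Proof. by rewrite /degree intrM mulrAC divff ?mul1r. Qed.

End Parity.

Section Zhu.
Variables (F : fieldType) (V : lmodType F) (S : half_graded V).
Variables (g : V -> V) (g_aut : is_automorphism S g).
Variable g_grade : preserves_grading S g.
Variables (T0 : nat) (gsigma_order : has_order (g \o sigma S) T0).
Variables (eps : F) (eps_prim : T0.-primitive_root eps).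

Let T0_gt0 : (0 < T0)%N := prim_order_gt0 eps_prim.

Local Notation B := (binomialF F).
Local Notation Y := (mode S).
Local Notation R := (Res_pow S).
Local Notation bigrade := (bigrade S g (T0 := T0) eps).
Local Notation circ := (circ S g T0 eps).
Local Notation star := (star S g T0 eps).
Local Notation O := (Og S g T0 eps).
Local Notation index := (int * 'I_T0)%type.

Let h : V -> V := g \o sigma S.

Let h_lin : linear h.
Proof.
have [g_lin _ _ _] := g_aut.
by move=> a u v; rewrite /h /= sigma_linear g_lin.
Qed.

Let h_grade k v : v \in grade S k -> h v \in grade S k.
Proof.
move=> vk; have [i /sigma_parity vi] := grade_parity vk.
rewrite /h /= vi; apply: g_grade.
have [Wsub _ _] := grade_direct S; have [W0 Wlin] := Wsub k.
by rewrite -[_ *: v]addr0 Wlin.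
Qed.

Let h_mode k l n u v : u \in grade S k -> v \in grade S l ->
  h (Y u n v) = Y (h u) n (h v).
Proof.
move=> uk vl; have [i ui] := grade_parity uk; have [j vj] := grade_parity vl.
have [_ _ _ g_mode] := g_aut.
rewrite /h /= (sigma_parity ui) (sigma_parity vj) -g_mode; congr g.
rewrite (sigma_parity (mode_parity n ui vj)).
by rewrite modeZl modeZr scalerA signr_addb.
Qed.

Lemma bigrade_direct : is_direct_sum bigrade predT.
Proof.
have [_ hn _] := gsigma_order.
exact: (eigen_direct_sum h_lin eps_prim hn (grade_direct S) h_grade).
Qed.

Lemma bigrade_ind (P : V -> Prop) :
    P 0 -> (forall u v, P u -> P v -> P (u + v)) ->
    (forall i v, v \in bigrade i -> P v) ->
  forall v, P v.
Proof.
by move=> P0 PD Pi v; exact: (direct_sum_ind bigrade_direct P0 PD Pi).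
Qed.

(** The bidegree of [u_n v] in terms of those of [u] and [v]: degrees, which
    are stored doubled, give [deg u + deg v - n - 1], and eigenvalues
    multiply. *)
Definition mode_index (i j : index) (n : int) : index :=
  (i.1 + j.1 - 2 * n - 2, Ordinal (ltn_pmod (i.2 + j.2) T0_gt0)).

Lemma bigrade_mode i j n u v : u \in bigrade i -> v \in bigrade j ->
  Y u n v \in bigrade (mode_index i j n).
Proof.
rewrite !inE /= => /andP[ui /eqP hu] /andP[vj /eqP hv].
rewrite grade_mode //= -[g _]/(h _) (h_mode _ ui vj) /h /= hu hv.
by rewrite modeZl modeZr scalerA -exprD (prim_expr_mod eps_prim) eqxx.
Qed.

Lemma bigrade_parity i u : u \in bigrade i -> exists b, u \in parity S b.
Proof. by rewrite inE => /andP[/grade_parity]. Qed.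

Lemma vac_bigrade : vac S \in bigrade (0, Ordinal T0_gt0).
Proof.
rewrite !inE grade_vac /= (sigma_parity (vac_even S)) !expr0 !scale1r.
by have [_ _ -> _] := g_aut.
Qed.

(** The exponent of [1 + z] in [circ n u v], for [u] of bidegree [i]. *)
Definition circ_exp (i : index) : rat :=
  if i.2 == 0%N :> nat then degree i.1
  else degree i.1 - 1 + (i.2 : nat)%:R / T0%:R.

(** The exponent of [1 / z] in [circ 0 u v], for [u] of bidegree [i]. *)
Definition circ_pole (i : index) : nat := if i.2 == 0%N :> nat then 2 else 1.

Lemma circ_homogE n (i : index) u v :
  circ_homog S n i u v = R (circ_exp i) (circ_pole i + n)%N%:Z u v.
Proof. by rewrite /circ_homog /circ_exp /circ_pole; case: ifP. Qed.

Lemma circ_homog_linear_l n (i : index) v :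
  linear (circ_homog S n i ^~ v : V -> V).
Proof. by move=> a x y /=; rewrite !circ_homogE Res_pow_linear_l. Qed.

Lemma circ_homog_linear_r n (i : index) u : linear (circ_homog S n i u).
Proof. by move=> a x y /=; rewrite !circ_homogE Res_pow_linear_r. Qed.

Lemma star_homog_linear_l (i : index) v : linear (star_homog S i ^~ v : V -> V).
Proof.
move=> a x y; rewrite /star_homog.
case: ifP => _; last by rewrite scaler0 addr0.
exact: Res_pow_linear_l.
Qed.

Lemma star_homog_linear_r (i : index) u : linear (star_homog S i u).
Proof.
move=> a x y; rewrite /star_homog.
case: ifP => _; last by rewrite scaler0 addr0.
exact: Res_pow_linear_r.
Qed.

Lemma circ_homog0l n (i : index) v : circ_homog S n i 0 v = 0.
Proof. by rewrite circ_homogE Res_pow0l. Qed.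

Lemma star_homog0l (i : index) v : star_homog S i 0 v = 0.
Proof. by rewrite /star_homog; case: ifP => // _; exact: Res_pow0l. Qed.

Lemma circ_linear_l n v : linear (circ n ^~ v).
Proof.
apply: (linear_extension_linear bigrade_direct) => i.
exact: circ_homog_linear_l.
Qed.

Lemma circ_linear_r n u : linear (circ n u).
Proof.
apply: (linear_extension_param bigrade_direct) => i x.
  exact: circ_homog_linear_r.
exact: circ_homog0l.
Qed.

Lemma star_linear_l v : linear (star ^~ v).
Proof.
apply: (linear_extension_linear bigrade_direct) => i.
exact: star_homog_linear_l.
Qed.

Lemma star_linear_r u : linear (star u).
Proof.
apply: (linear_extension_param bigrade_direct) => i x.
  exact: star_homog_linear_r.
exact: star_homog0l.
Qed.

Lemma circ_on i n u v : u \in bigrade i ->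
  circ n u v = R (circ_exp i) (circ_pole i + n)%N%:Z u v.
Proof.
move=> ui; rewrite -circ_homogE.
apply: (linear_extension_homog bigrade_direct _ ui) => j.
exact: circ_homog0l.
Qed.

Lemma star_on i u v : u \in bigrade i ->
  star u v = if i.2 == 0%N :> nat then R (degree i.1) 1 u v else 0.
Proof.
move=> ui; apply: (linear_extension_homog bigrade_direct _ ui) => j.
exact: star_homog0l.
Qed.

Lemma star_on0 i u v : u \in bigrade i -> i.2 = 0%N :> nat ->
  star u v = R (circ_exp i) 1 u v.
Proof. by move=> /star_on -> i0; rewrite /circ_exp i0. Qed.

Lemma star_off0 i u v : u \in bigrade i -> i.2 != 0%N :> nat -> star u v = 0.
Proof. by move=> /star_on -> /negPf ->. Qed.

Let star0l v : star 0 v = 0.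
Proof. exact: (linear_zero (star_linear_l v)). Qed.

Let star0r v : star v 0 = 0.
Proof. exact: (linear_zero (star_linear_r v)). Qed.

Let starDl u v w : star (u + v) w = star u w + star v w.
Proof. by have := star_linear_l w 1 u v; rewrite /= !scale1r. Qed.

Let starDr u v w : star w (u + v) = star w u + star w v.
Proof. by have := star_linear_r w 1 u v; rewrite /= !scale1r. Qed.

Lemma circ_Og n u v : circ n u v \in O.
Proof.
apply/asboolP; exists [:: (1, circ n u v)]; last by rewrite big_seq1 scale1r.
by move=> x; rewrite inE => /eqP ->; exists u, v, n.
Qed.

Lemma Og_ind (P : V -> Prop) :
    P 0 -> (forall a u v, P u -> P v -> P (a *: u + v)) ->
    (forall n u v, P (circ n u v)) ->
  forall w, w \in O -> P w.
Proof.
move=> P0 Plin Pcirc w /asboolP[s sP ->].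
elim: s sP => [|x s IH] sP; first by rewrite big_nil.
rewrite big_cons; apply: Plin; last first.
  by apply: IH => y ys; apply: sP; rewrite inE ys orbT.
by have [u [v [n ->]]] := sP x (mem_head _ _).
Qed.

Lemma degree_mode i j n :
  degree (mode_index i j n).1 = degree i.1 + degree j.1 - (n + 1)%:~R.
Proof.
have -> : (mode_index i j n).1 = i.1 + j.1 + 2 * (- (n + 1)).
  by rewrite /mode_index /=; lia.
by rewrite !degreeD degree2 intrN.
Qed.

(** Acting with the modes of a vector fixed by [g sigma] shifts the exponent of
    a vector as it shifts its degree. *)
Lemma circ_exp_mode (i j : index) n : i.2 = 0%N :> nat ->
  circ_exp (mode_index i j n) = circ_exp i + circ_exp j - (n + 1)%:~R.
Proof.
move=> i0; rewrite /circ_exp degree_mode /= i0 add0n modn_small //=.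
by case: ifP => _; ring.
Qed.

Lemma circ_pole_mode (i j : index) n : i.2 = 0%N :> nat ->
  circ_pole (mode_index i j n) = circ_pole j.
Proof. by move=> i0; rewrite /circ_pole /= i0 add0n modn_small. Qed.

(** The two indices have opposite eigenvalues: both are [0], or their sum
    is [T0]. *)
Let index_opp (i j : index) : ((i.2 + j.2) %% T0)%N = 0%N ->
  (i.2 = 0%N :> nat /\ j.2 = 0%N :> nat)
  \/ [/\ i.2 != 0%N :> nat, j.2 != 0%N :> nat & (i.2 + j.2 = T0)%N].
Proof.
case: i j => [k [x xT]] [l [y yT]] /= /eqP; rewrite -/(dvdn _ _).
move=> /dvdnP[[|[|q]] xy]; last by nia.
  by left; lia.
rewrite mul1n in xy.
by right; split=> //; apply/eqP; lia.
Qed.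

Lemma circ_pole_opp (i j : index) : ((i.2 + j.2) %% T0)%N = 0%N ->
  circ_pole j = circ_pole i.
Proof.
rewrite /circ_pole => /index_opp[[-> ->] //|[i0 j0 _]].
by rewrite (negPf i0) (negPf j0).
Qed.

(** If [u] and [v] have opposite eigenvalues then [u_n v] is fixed by
    [g sigma], and [star] on it uses its degree, to which the fractional parts
    [r / T0] and [1 - r / T0] of the two exponents contribute an integer. *)
Lemma circ_expD (i j : index) : ((i.2 + j.2) %% T0)%N = 0%N ->
  circ_exp i + circ_exp j = degree i.1 + degree j.1 + (circ_pole i)%:R - 2.
Proof.
rewrite /circ_exp /circ_pole => /index_opp[[-> ->]|[i0 j0 ijT]].
  by rewrite addrK.
rewrite (negPf i0) (negPf j0).
have T0_neq0 : T0%:R != 0 :> rat by rewrite pnatr_eq0 -lt0n.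
have : (i.2 : nat)%:R / T0%:R + (j.2 : nat)%:R / T0%:R = 1 :> rat.
  by rewrite -mulrDl -natrD ijT divff.
move: (_ / _) (_ / _) => x y xy.
by rewrite addrACA xy; ring.
Qed.

(** Vectors with a nontrivial eigenvalue lie in [O], being products with the
    vacuum. *)
Lemma bigrade_Og i v : v \in bigrade i -> i.2 != 0%N :> nat -> v \in O.
Proof.
move=> vi i0; rewrite -(Res_pow_vac_r S (circ_exp i) v).
have := circ_Og 0 v (vac S); rewrite (circ_on _ _ vi) /circ_pole.
by rewrite (negPf i0) addn0.
Qed.

Lemma star_vac_l v : star (vac S) v = v.
Proof. by rewrite (star_on0 _ vac_bigrade) // Res_pow_vac_l. Qed.

Lemma star_vac_r v : star v (vac S) - v \in O.
Proof.
elim/bigrade_ind: v => [|u v uO vO|i v vi].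
- by rewrite star0l subrr rpred0.
- by rewrite starDl opprD addrACA rpredD.
have [i0|i0] := eqVneq (i.2 : nat) 0%N.
  by rewrite (star_on0 _ vi i0) Res_pow_vac_r subrr rpred0.
by rewrite (star_off0 _ vi i0) sub0r rpredN (bigrade_Og vi i0).
Qed.

Section Characteristic.
Variables (p : nat) (p_char : p \in [pchar F]) (p_gt2 : (2 < p)%N).
Let p_prime : prime p := pcharf_prime p_char.
Local Notation D := (p_integral p).

Lemma degree_p_integral k : degree k \in D.
Proof.
apply: (@p_integral_frac p k 2).
by rewrite coprime_sym prime_coprime // gtnNdvd.
Qed.

Lemma circ_exp_p_integral i : circ_exp i \in D.
Proof.
rewrite /circ_exp; case: ifP => _; first exact: degree_p_integral.
rewrite rpredD ?rpredB ?degree_p_integral ?rpred1 //.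
apply: (@p_integral_frac p (i.2 : nat) T0).
rewrite coprime_sym prime_coprime //; apply/negP => pT0.
by have := prim_root_pcharF eps_prim pT0; rewrite p_char.
Qed.

(** [O] contains the products [circ] in which [1 + z] has a larger exponent,
    if the pole at [z = 0] is larger by at least as much. *)
Lemma Res_pow_Og i u v m n : u \in bigrade i -> (m <= n)%N ->
  R (circ_exp i + m%:R) (circ_pole i + n)%N%:Z u v \in O.
Proof.
move=> ui; elim: m n => [|m IH] n mn.
  by rewrite addr0 -circ_on // circ_Og.
rewrite -natr1 addrA (Res_pow_Pascal _ p_char); last first.
  by rewrite rpredD ?circ_exp_p_integral ?rpred_nat.
case: n mn => // n mn; apply: rpredD; first by apply: IH; apply: leqW.
have -> : (circ_pole i + n.+1)%N%:Z - 1 = (circ_pole i + n)%N%:Z by lia.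
exact: IH.
Qed.

Lemma Res_pow_Og_eq i u v m n al s : u \in bigrade i -> (m <= n)%N ->
  al = circ_exp i + m%:R -> s = (circ_pole i + n)%N%:Z -> R al s u v \in O.
Proof. by move=> ui mn -> ->; exact: Res_pow_Og. Qed.

(** [O] is a left ideal. For [u] fixed by [g sigma], the commutator formula
    writes [star u (circ n a b)] as a multiple of [circ n a (star u b)] plus
    products of the [u_t a] with [b], which have the exponent of [u_t a]
    raised by [t - l + 1] and the pole raised by as much. *)
Lemma star_circ_Og u n a b : star u (circ n a b) \in O.
Proof.
elim/bigrade_ind: u => [|u v uO vO|i u ui]; first by rewrite star0l rpred0.
  by rewrite starDl rpredD.
have [i0|i0] := eqVneq (i.2 : nat) 0%N; last first.
  by rewrite (star_off0 _ ui i0) rpred0.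
elim/bigrade_ind: a => [|a c aO cO|j a aj].
- by rewrite (linear_zero (circ_linear_l n b)) star0r rpred0.
- have := circ_linear_l n b 1 a c; rewrite /= !scale1r => ->.
  by rewrite starDr rpredD.
rewrite (star_on0 _ ui i0) (circ_on _ _ aj).
have [[pu uP] [pa aP]] := (bigrade_parity ui, bigrade_parity aj).
have [K [c ->]] := Res_commutator p_char b 1 (circ_pole j + n)%N%:Z
  (circ_exp_p_integral i) (circ_exp_p_integral j) uP aP.
rewrite rpredD ?rpredZ -?circ_on ?circ_Og // rpred_sum // => t _.
rewrite rpred_sum // => l _; rewrite rpredZ //.
have lt : (l <= t)%N by rewrite -ltnS.
have utj := bigrade_mode t%:Z ui aj.
apply: (Res_pow_Og_eq _ (m := (t - l).+1) (n := n + (t - l).+1) utj).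
- exact: leq_addl.
- by rewrite circ_exp_mode // -natr1 natrB // intrD -[(t%:Z)%:~R]/(t%:R); ring.
by rewrite circ_pole_mode //; lia.
Qed.

(** [O] is a right ideal. The product [star (circ n a b) u] is a residue of
    [Y(Y(a, x0) b, x2) u], which the iterate formula writes in terms of
    products with left factor [a] and of products with left factor [b]; for
    the latter, the exponent of [b] is raised by [n + 1], but the pole is
    raised by at least [n + 1]. *)
Lemma circ_star_Og n a b u : star (circ n a b) u \in O.
Proof.
elim/bigrade_ind: a => [|a c aO cO|i a ai].
- by rewrite (linear_zero (circ_linear_l n b)) star0l rpred0.
- have := circ_linear_l n b 1 a c; rewrite /= !scale1r => ->.
  by rewrite starDl rpredD.
elim/bigrade_ind: b => [|b c bO cO|j b bj].
- by rewrite (linear_zero (circ_linear_r n a)) star0l rpred0.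
- have := circ_linear_r n a 1 b c; rewrite /= !scale1r => ->.
  by rewrite starDl rpredD.
have ab t := bigrade_mode t ai bj.
rewrite (circ_on _ _ ai); set s := (circ_pole i + n)%N.
have [K0 abK] := Res_pow_truncated S (circ_exp i) s%:Z a b.
have [[pa aP] [pb bP]] := (bigrade_parity ai, bigrade_parity bj).
(* The exponent of 1 + x2 is the one for which star (a_m b) u, whose exponent
   is deg (a_m b), is the residue of the iterate: see expE below *)
have beD : circ_exp j + n.+1%:R \in D.
  by rewrite rpredD ?circ_exp_p_integral ?rpred_nat.
have [K1 [c itK]] :=
  Res_iterate p_char u s%:Z 1 (circ_exp_p_integral i) beD aP bP.
have {}itK := itK _ (leq_addl K0 K1).
rewrite (abK _ (leq_addr K1 K0)) (linear_lincomb _ _ _ _ (star_linear_l u)).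
have [ij0|ij0] := eqVneq ((i.2 + j.2) %% T0)%N 0%N; last first.
  rewrite rpred_sum // => t _.
  by rewrite rpredZ // (star_off0 _ (ab _)) ?rpred0.
have poleE := circ_pole_opp ij0.
have expE := circ_expD ij0.
have -> : \sum_(t < K0 + K1) B (circ_exp i) t *: star (Y a (t%:Z - s%:Z) b) u
   = \sum_(t < K0 + K1) B (circ_exp i) t *:
       R (circ_exp i - t%:R + (circ_exp j + n.+1%:R)) 1 (Y a (t%:Z - s%:Z) b) u.
  apply: eq_bigr => t _; rewrite (star_on _ (ab _)) /= ij0 eqxx degree_mode.
  have -> : degree i.1 + degree j.1 - (t%:Z - s%:Z + 1)%:~R
      = circ_exp i - t%:R + (circ_exp j + n.+1%:R).
    rewrite addrACA expE -natr1 !(intrD, intrN) /s.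
    rewrite -[((_ + n)%N%:Z)%:~R]/((_ + n)%N%:R) natrD -[(t%:Z)%:~R]/(t%:R).
    by ring.
  by [].
rewrite itK rpred_sum // => t _; rewrite rpredZ // rpredB ?rpredZ //.
  apply: (Res_pow_Og_eq _ (m := 0) (n := n + t) ai) => //.
    by rewrite addr0.
  by rewrite /s; lia.
apply: (Res_pow_Og_eq _ (m := n.+1) (n := n.+1 + t) bj) => //.
  exact: leq_addr.
by rewrite poleE /s; lia.
Qed.

(** For [u] and [v] fixed by [g sigma] this is the iterate formula with
    [s0 = 1], in which [(x1 - x2)^(-1)] is expanded in powers of [x2 / x1] or
    of [x1 / x2]. The leading term of the first expansion is
    [star u (star v w)], and all the others have a pole of order at least [2]
    on the left factor. *)
Lemma star_assoc u v w : star u (star v w) - star (star u v) w \in O.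
Proof.
elim/bigrade_ind: u => [|u u' uO uO'|i u ui].
- by rewrite !star0l subrr rpred0.
- by rewrite !starDl opprD addrACA rpredD.
have [i0|i0] := eqVneq (i.2 : nat) 0%N; last first.
  by rewrite !(star_off0 _ ui i0) star0l subrr rpred0.
elim/bigrade_ind: v => [|v v' vO vO'|j v vj].
- by rewrite star0r star0l star0r subrr rpred0.
- by rewrite !(starDl, starDr) opprD addrACA rpredD.
have uv t := bigrade_mode t ui vj.
rewrite !(star_on0 _ ui i0).
have [K0 uvK] := Res_pow_truncated S (circ_exp i) 1 u v.
have [[pu uP] [pv vP]] := (bigrade_parity ui, bigrade_parity vj).
have [K1 [c itK]] := Res_iterate p_char w 1 1 (circ_exp_p_integral i)
  (circ_exp_p_integral j) uP vP.
have {}itK := itK _ (leq_trans (leq_addl K0 K1) (leqnSn _)).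
rewrite (uvK (K0 + K1).+1); last by lia.
rewrite (linear_lincomb _ _ _ _ (star_linear_l w)).
have [j0|j0] := eqVneq (j.2 : nat) 0%N; last first.
  rewrite (star_off0 _ vj j0) Res_pow0r sub0r rpredN.
  rewrite rpred_sum // => t _.
  rewrite rpredZ // (star_off0 _ (uv _)) ?rpred0 //=.
  by rewrite i0 add0n modn_small.
have -> : \sum_(t < (K0 + K1).+1) B (circ_exp i) t *: star (Y u (t%:Z - 1) v) w
   = \sum_(t < (K0 + K1).+1) B (circ_exp i) t *:
       R (circ_exp i - t%:R + circ_exp j) 1 (Y u (t%:Z - 1) v) w.
  apply: eq_bigr => t _; rewrite (star_on0 _ (uv _)); last first.
    by rewrite /= i0 j0 mod0n.
  rewrite circ_exp_mode // subrK -[(t%:Z)%:~R]/(t%:R).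
  by rewrite addrAC.
have pole_i : circ_pole i = 2 by rewrite /circ_pole i0.
have pole_j : circ_pole j = 2 by rewrite /circ_pole j0.
have vO t : R (circ_exp j) (1 + 1 + t%:Z) v (R (circ_exp i) (- t%:Z) u w) \in O.
  apply: (Res_pow_Og_eq _ (m := 0) (n := t) vj) => //; first by rewrite addr0.
  by rewrite pole_j; lia.
rewrite itK big_ord_recl /= binomialF0 expr0 mul1r scale1r.
have -> : 1 + Posz 0 = 1 by [].
rewrite (star_on0 _ vj j0) opprD opprB addrA addrCA subrr addr0.
rewrite rpredB //; first by rewrite rpredZ //; exact: (vO 0%N).
rewrite rpred_sum // => t _; rewrite rpredZ // rpredB ?rpredZ //.
apply: (Res_pow_Og_eq _ (m := 0) (n := t) ui) => //; first by rewrite addr0.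
by rewrite /bump leq0n pole_i; lia.
Qed.

Lemma Og_ideal : two_sided_ideal star O.
Proof.
split; first exact: submodClosedP.
move=> a b bO; split.
  elim/Og_ind: bO => [|c x y xO yO|n x y]; last exact: star_circ_Og.
    by rewrite star0r rpred0.
  by rewrite star_linear_r rpredD ?rpredZ.
elim/Og_ind: bO => [|c x y xO yO|n x y]; last exact: circ_star_Og.
  by rewrite star0l rpred0.
by have /= -> := star_linear_l a c x y; rewrite rpredD ?rpredZ.
Qed.

End Characteristic.

End Zhu.

(** * The quotient algebra *)

Lemma to_quotient_surj (F : fieldType) (V : lmodType F) (W : submodClosed V)
    (x : quotient_space W) : exists v, to_quotient W v = x.
Proof.
exists (repr (x : Quotient.quot _)); exact: reprK.
Qed.

(** A bilinear product for which [W] is an ideal, and which is associative and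
    unital modulo [W], descends to the quotient by [W]. *)
Lemma quotient_algebra (F : fieldType) (V : lmodType F) (W : submodClosed V)
    (m : V -> V -> V) (e : V) :
    (forall u, linear (m u)) -> (forall v, linear (m ^~ v)) ->
    (forall a b, b \in W -> m a b \in W /\ m b a \in W) ->
    (forall u v w, m u (m v w) - m (m u v) w \in W) ->
    (forall v, m e v - v \in W) -> (forall v, m v e - v \in W) ->
  exists mul : quotient_space W -> quotient_space W -> quotient_space W,
    (forall a b, mul (to_quotient W a) (to_quotient W b)
                 = to_quotient W (m a b)) /\
    unital_associative_algebra mul (to_quotient W e).
Proof.
move=> m_lin_r m_lin_l W_ideal m_assoc m_unit_l m_unit_r.
have [lift liftK] := choice (@to_quotient_surj F V W).
pose mul x y := to_quotient W (m (lift x) (lift y)).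
have mulE a b : mul (to_quotient W a) (to_quotient W b) = to_quotient W (m a b).
  apply/to_quotient_eq.
  set a' := lift _; set b' := lift _.
  have aa : a' - a \in W by apply/to_quotient_eq; rewrite liftK.
  have bb : b' - b \in W by apply/to_quotient_eq; rewrite liftK.
  have -> : m a' b' - m a b = m (a' - a) b' + m a (b' - b).
    have := m_lin_l b' (-1) a a'; have := m_lin_r a (-1) b b'.
    rewrite !scaleN1r ![- _ + _]addrC /= => -> ->.
    by rewrite !addrA subrK.
  have [_ aW] := W_ideal b' _ aa; have [bW _] := W_ideal a _ bb.
  by rewrite rpredD.
exists mul; split=> //; split.
- move=> x c y z; rewrite -(liftK x) -(liftK y) -(liftK z).
  by rewrite -to_quotient_is_linear !mulE -to_quotient_is_linear m_lin_r.
- move=> x c y z; rewrite -(liftK x) -(liftK y) -(liftK z) /=.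
  by rewrite -to_quotient_is_linear !mulE -to_quotient_is_linear m_lin_l.
- move=> x y z; rewrite -(liftK x) -(liftK y) -(liftK z) !mulE.
  exact/to_quotient_eq.
- by move=> x; rewrite -(liftK x) mulE; apply/to_quotient_eq.
- by move=> x; rewrite -(liftK x) mulE; apply/to_quotient_eq.
Qed.

Theorem theorem4p6 (F : closedFieldType) (p : nat)
    (p_char : p \in [pchar F]) (p_gt2 : (2 < p)%N)
    (V : lmodType F) (S : half_graded V)
    (g : V -> V) (g_aut : is_automorphism S g) (g_grade : preserves_grading S g)
    (T : nat) (g_order : has_order g T) (T_p : coprime T p)
    (T0 : nat) (gsigma_order : has_order (g \o sigma S) T0)
    (eps : F) (eps_prim : T0.-primitive_root eps) :
  two_sided_ideal (star S g T0 eps) (Og S g T0 eps) /\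
  exists mul : Ag S g T0 eps -> Ag S g T0 eps -> Ag S g T0 eps,
    (forall a b : V, mul (to_Ag S g T0 eps a) (to_Ag S g T0 eps b)
                     = to_Ag S g T0 eps (star S g T0 eps a b)) /\
    unital_associative_algebra mul (to_Ag S g T0 eps (vac S)).
Proof.
have star_lin_l := star_linear_l g_aut g_grade gsigma_order eps_prim.
have star_lin_r := star_linear_r g_aut g_grade gsigma_order eps_prim.
have O_ideal := Og_ideal g_aut g_grade gsigma_order eps_prim p_char p_gt2.
split; first exact: O_ideal.
have [_ O_stable] := O_ideal.
apply: (quotient_algebra star_lin_r star_lin_l O_stable).
- exact: (star_assoc g_aut g_grade gsigma_order eps_prim p_char p_gt2).
- move=> v; rewrite (star_vac_l g_aut g_grade gsigma_order eps_prim).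
  by rewrite subrr rpred0.
- exact: (star_vac_r g_aut g_grade gsigma_order eps_prim).
Qed.
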